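(* Consider an asymptotically polytropic equation of state whose index function satisfies $n(\eta)\le5$ for all $\eta>0$ and $n(\eta)<5$ for all sufficiently small $\eta>0$. Then every regular perfect fluid solution, and every solution possessing a negative mass singularity at the center, has finite radius and finite total mass.
   Context: Equation of state: a barotropic relation $\rho=\rho(p)$, defined for $p\ge 0$, with $\rho>0$ for $p>0$, such that $\eta(p)=\int_0^p dp'/\rho(p')$ is finite for $p>0$; $\rho,p$ are regarded as functions of $\eta$. Index function: $n(\eta)=\frac{\eta}{\rho}\frac{d\rho}{d\eta}$. Asymptotically polytropic: $n$ is $C^1$ on $(0,\infty)$, bounded and non-negative on $[0,\infty]$, and $n(\eta)-n_0=O(\eta^{a_0})$ as $\eta\to0$, $n(\eta)-n_1=O(\eta^{-a_1})$ as $\eta\to\infty$ for some $n_0,n_1\ge0$, $a_0,a_1>0$. Perfect fluid solutions solve $dm/dr=4\pi r^2\rho(p)$, $dp/dr=-m\rho(p)/r^2$, continued outward while $p>0$. Regular: $m(r)\to0$, $p(r)\to p_c\in(0,\infty)$ as $r\to0$. Negative mass singularity: near $r=0$ the Newtonian potential behaves like $-M_-/r+\text{const}$ with $M_-<0$, i.e. $m(r)\to M_-<0$ as $r\to0$ (the fluid region begins at some radius where $p$ first becomes positive, $m$ then increases through $0$). Finite radius and mass: there is $R<\infty$ with $p\to0$ as $r\to R$ and $m(R)<\infty$. *)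

(* Defs.v *)
From HB Require Import structures.
From mathcomp Require Import all_boot all_order all_algebra.
From mathcomp Require Import all_classical all_reals all_analysis.
Set Implicit Arguments. Unset Strict Implicit. Unset Printing Implicit Defensive.
Import Order.TTheory GRing.Theory Num.Theory.
Import numFieldNormedType.Exports.
Local Open Scope classical_set_scope.
Local Open Scope ring_scope.

Section StellarDefs.
Variable R : realType.

Definition eta_of (rho : R -> R) (p : R) : R :=
  fine (\int[lebesgue_measure]_(x in `](0%R : R), p]%classic) ((rho x)^-1)%:E)%E.

Definition barotropic_eos (rho Pe : R -> R) : Prop :=
  [/\ (forall p : R, 0 < p -> 0 < rho p),
      (forall p : R, 0 < p ->
         lebesgue_measure.-integrable `]0, p] (fun x => ((rho x)^-1)%:E)),
      (forall p : R, 0 <= p -> Pe (eta_of rho p) = p) &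
      (forall e : R, 0 <= e -> 0 <= Pe e /\ eta_of rho (Pe e) = e)].

Definition rho_eta (rho Pe : R -> R) : R -> R := rho \o Pe.

Definition n_index (rho Pe : R -> R) (e : R) : R :=
  e / rho_eta rho Pe e * derive1 (rho_eta rho Pe) e.

Definition asymptotically_polytropic (rho Pe : R -> R) : Prop :=
  let n := n_index rho Pe in
  [/\
      (forall e : R, 0 < e ->
         [/\ derivable (rho_eta rho Pe) e 1, derivable n e 1 &
             {for e, continuous (derive1 n)}]),
      (exists B : R, forall e : R, 0 < e -> 0 <= n e <= B) &
      exists n0 n1 a0 a1 : R,
        [/\ 0 <= n0 /\ 0 <= n1, 0 < a0 /\ 0 < a1,
            (exists C d : R, 0 < d /\
               forall e : R, 0 < e < d -> `|n e - n0| <= C * e `^ a0) &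
            (exists C K : R, 0 < K /\
               forall e : R, K < e -> `|n e - n1| <= C * e `^ (- a1))]].

Definition fluid_solution (rho : R -> R) (r0 : R) (Rad : \bar R)
    (m p : R -> R) : Prop :=
  [/\ 0 <= r0, (r0%:E < Rad)%E &
      forall r : R, r0 < r -> (r%:E < Rad)%E ->
        [/\ 0 < p r,
            is_derive r 1 m (4 * pi * r ^+ 2 * rho (p r)) &
            is_derive r 1 p (- (m r * rho (p r)) / r ^+ 2)]].

Definition maximal_fluid_solution (rho : R -> R) (r0 : R) (Rad : \bar R)
    (m p : R -> R) : Prop :=
  fluid_solution rho r0 Rad m p /\
  forall (Rad' : \bar R) (m' p' : R -> R),
    fluid_solution rho r0 Rad' m' p' ->
    (forall r : R, r0 < r -> (r%:E < Rad)%E -> m' r = m r /\ p' r = p r) ->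
    (Rad' <= Rad)%E.

Definition regular_center (r0 : R) (m p : R -> R) : Prop :=
  r0 = 0 /\ m r @[r --> 0^'+] --> 0 /\
  exists pc : R, 0 < pc /\ p r @[r --> 0^'+] --> pc.

(* negative mass singularity: inside r0 there is vacuum (p -> 0 at r0 if
   r0 > 0), the mass tends to M_- < 0 at the inner edge of the fluid
   region, so the Newtonian potential is -M_-/r + const near r = 0. *)
Definition negative_mass_center (r0 : R) (m p : R -> R) : Prop :=
  exists Mneg : R, Mneg < 0 /\ m r @[r --> r0^'+] --> Mneg /\
    (r0 = 0 \/ p r @[r --> r0^'+] --> 0).

Definition finite_radius_mass (Rad : \bar R) (m p : R -> R) : Prop :=
  exists Rf : R, Rad = Rf%:E /\ p r @[r --> Rf^'-] --> 0 /\
    exists M : R, m r @[r --> Rf^'-] --> M.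

End StellarDefs.

(* Main.v *)
Require Import Defs.
From HB Require Import structures.
From mathcomp Require Import all_boot all_order all_algebra.
From mathcomp Require Import all_classical all_reals all_analysis.
From mathcomp Require Import ring lra.
Import Order.TTheory GRing.Theory Num.Theory.
Import numFieldNormedType.Exports.
Set Implicit Arguments. Unset Strict Implicit. Unset Printing Implicit Defensive.
Local Open Scope ring_scope.

(** With [u = eta(p)] the equations become [u' = - m / r^2] and
    [m' = 4 pi r^2 rho(u)].

    If the radius is finite then [m] and [u] have limits there, and a positive
    limit of [u] would let Picard iteration continue the solution; so [u -> 0].

    If the radius were infinite, the Pohozaev function
    [Q = m^2 / (2 r) + 4 pi r^3 p - m u / 2] satisfies
    [Q' = 2 pi r^2 (6 p - rho u)], and [6 p - rho u > 0] since its derivative in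
    [u] is [rho (5 - n)].  Both kinds of center make [Q] positive somewhere.
    On the other hand [m <= r u] and [pi r^3 rho <= m] give [Q <= 4 r u^2], so
    [r u^2] stays away from 0; hence [rho / u^5], which is nonincreasing in [u],
    is bounded, so that asymptotically [rho u >= 4 p], and [r u^2] is bounded
    above too.  Then [z = 1 / (r u^2)] satisfies [d^2 z / (d ln r)^2 >= z / 2],
    and [|dz / d ln r| <= z]: the slope of [z] tends to infinity and stays
    bounded, a contradiction. *)

(** * Calculus and local existence for planar systems *)

Section Calculus.
Local Open Scope classical_set_scope.
Local Open Scope ring_scope.
Variable R : realType.
Implicit Types (f g df : R -> R) (a b c d x : R).

Lemma is_derive_continuous f x b : is_derive x 1 f b -> {for x, continuous f}.
Proof.
by move=> [fx _]; apply/differentiable_continuous/derivable1_diffP.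
Qed.

Lemma is_derive_near f g x b : (\near x, f x = g x) ->
  is_derive x 1 f b -> is_derive x 1 g b.
Proof.
move=> fg [fx <-]; split; first exact: near_eq_derivable fx.
by apply/esym; apply: near_eq_derive.
Qed.

Lemma is_derive_funC a x : is_derive x 1 (fun=> a : R) 0.
Proof. by have := is_derive_cst a x (1 : R). Qed.

Lemma is_derive_funD f g x a b : is_derive x 1 f a -> is_derive x 1 g b ->
  is_derive x 1 (fun y => f y + g y) (a + b).
Proof. by move=> fa gb; have := is_deriveD fa gb. Qed.

Lemma is_derive_funB f g x a b : is_derive x 1 f a -> is_derive x 1 g b ->
  is_derive x 1 (fun y => f y - g y) (a - b).
Proof. by move=> fa gb; have := is_deriveB fa gb. Qed.

Lemma is_derive_funM f g x a b : is_derive x 1 f a -> is_derive x 1 g b ->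
  is_derive x 1 (fun y => f y * g y) (f x * b + g x * a).
Proof. by move=> fa gb; have := is_deriveM fa gb. Qed.

Lemma is_derive_funX f n x a : is_derive x 1 f a ->
  is_derive x 1 (fun y => f y ^+ n) (n%:R * f x ^+ n.-1 * a).
Proof. by move=> fa; have := is_deriveX n fa; rewrite exprfctE. Qed.

Lemma is_derive_funV f x a : f x != 0 -> is_derive x 1 f a ->
  is_derive x 1 (fun y => (f y)^-1) (- (f x) ^- 2 * a).
Proof. exact: is_deriveV. Qed.

Lemma mean_value f df a b : a < b ->
  (forall x, a <= x <= b -> is_derive x 1 f (df x)) ->
  exists2 c, a < c < b & f b - f a = df c * (b - a).
Proof.
move=> ab fdf.
have [||c] := @MVT R f df a b ab.
- by move=> x; rewrite in_itv/= => /andP[ax xb]; apply: fdf; rewrite !ltW.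
- apply: continuous_in_subspaceT => x; rewrite inE/= in_itv/= => xab.
  exact: is_derive_continuous (fdf _ xab).
- by rewrite in_itv/=; exists c.
Qed.

Lemma is_derive_ndecr f df a b : a <= b ->
  (forall x, a <= x <= b -> is_derive x 1 f (df x)) ->
  (forall x, a <= x <= b -> 0 <= df x) -> f a <= f b.
Proof.
rewrite le_eqVlt => /predU1P[->//|ab] fdf df0.
have [c /andP[ac cb] E] := mean_value ab fdf.
by rewrite -subr_ge0 E mulr_ge0 ?subr_ge0 ?(ltW ab)// df0// !ltW.
Qed.

Lemma is_derive_incr f df a b : a < b ->
  (forall x, a <= x <= b -> is_derive x 1 f (df x)) ->
  (forall x, a <= x <= b -> 0 < df x) -> f a < f b.
Proof.
move=> ab fdf df0.
have [c /andP[ac cb] E] := mean_value ab fdf.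
by rewrite -subr_gt0 E mulr_gt0 ?subr_gt0// df0// !ltW.
Qed.

(** The mean value theorem turns each difference quotient at [x] into a value of [df] at a point
    between, and [df] is continuous at [x]. This serves at the junction of two glued solutions,
    where the equations are known only on either side. *)
Lemma is_derive_lim f df x : {for x, continuous f} ->
  {for x, continuous df} ->
  (\forall y \near x, y != x -> is_derive y 1 f (df y)) ->
  is_derive x 1 f (df x).
Proof.
move=> fx dfx [/= e0 e0_gt0 fdf].
have lim : h^-1 *: (f (h *: 1 + x) - f x) @[h --> 0^'] --> df x.
  apply/cvgrPdist_lt => e e_gt0.
  move/cvgrPdist_lt : dfx => /(_ e e_gt0) [/= e1 e1_gt0 dfe].
  exists (Num.min e0 e1) => /=; first by rewrite lt_min e0_gt0.
  move=> h /=; rewrite sub0r normrN lt_min => /andP[he0 he1] h0.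
  rewrite /GRing.scale /= mulr1.
  have cont y z : y <= z -> x <= z < x + e0 -> x - e0 < y <= x ->
      {within `[y, z]%classic, continuous f}.
    move=> yz /andP[xz zx] /andP[xy yx].
    apply: continuous_in_subspaceT => w; rewrite inE/= in_itv/= => /andP[yw wz].
    have [->//|wx] := eqVneq w x.
    apply: (@is_derive_continuous _ _ (df w)); apply: fdf => //=.
    by rewrite ltr_norml; apply/andP; split; lra.
  have [h_gt0|h_lt0|h_eq0] := ltgtP 0 h; last by rewrite h_eq0 eqxx in h0.
  - rewrite gtr0_norm// in he0 he1.
    have xh : x < h + x by rewrite ltrDr.
    have [||c] := @MVT R f df _ _ xh.
    + move=> y; rewrite in_itv/= => /andP[xy yx].
      apply: fdf => /=; last by rewrite gt_eqF.
      by rewrite ltr_norml; apply/andP; split; lra.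
    + by apply: cont; [exact: ltW|apply/andP; split; lra..].
    rewrite in_itv/= => /andP[xc cx] ->.
    rewrite addrK mulrC mulfK//.
    by apply: dfe => /=; rewrite ltr_norml; apply/andP; split; lra.
  - rewrite ltr0_norm// in he0 he1.
    have xh : h + x < x by rewrite gtrDr.
    have [||c] := @MVT R f df _ _ xh.
    + move=> y; rewrite in_itv/= => /andP[xy yx].
      apply: fdf => /=; last by rewrite lt_eqF.
      by rewrite ltr_norml; apply/andP; split; lra.
    + by apply: cont; [exact: ltW|apply/andP; split; lra..].
    rewrite in_itv/= => /andP[xc cx] E.
    have -> : h^-1 * (f (h + x) - f x) = df c.
      have -> : f (h + x) - f x = df c * h by rewrite -opprB E; ring.
      by rewrite mulrC mulfK.
    by apply: dfe => /=; rewrite ltr_norml; apply/andP; split; lra.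
split; first by apply/cvg_ex; exists (df x).
by apply/cvg_lim => //; exact: Rhausdorff.
Qed.

(** * Truncation to an interval, contractions and Picard iteration *)

Definition clamp c d x := Num.max c (Num.min x d).

Lemma clamp_itv c d x : c <= d -> c <= clamp c d x <= d.
Proof.
by move=> cd; rewrite /clamp le_max lexx /= ge_max cd ge_min lexx orbT.
Qed.

Lemma clamp_id c d x : c <= x <= d -> clamp c d x = x.
Proof.
by case/andP=> cx xd; rewrite /clamp (min_idPl xd) (max_idPr cx).
Qed.

Lemma clamp_continuous c d : continuous (clamp c d).
Proof.
have -> : clamp c d = (cst c : R -> R^o) \max ((id : R -> R^o) \min cst d).
  exact/funext.
move=> x; apply: continuous_max; first exact: cst_continuous.
by apply: continuous_min; [exact: cvg_id|exact: cst_continuous].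
Qed.

Lemma clamp_lip c d x y : c <= d -> `|clamp c d x - clamp c d y| <= `|x - y|.
Proof.
move=> cd; rewrite /clamp.
wlog xy : x y / x <= y.
  move=> H; have [xy|/ltW yx] := leP x y; first exact: H.
  by rewrite distrC (distrC x); exact: H.
rewrite (ler0_norm (_ : x - y <= 0)) ?subr_le0// opprB.
by rewrite /Num.max /Num.min ler_norml; do ![case: ifPn]; rewrite -?leNgt => *; apply/andP; split; lra.
Qed.

(** The intervals of radius [2 * D / 2 ^+ k] around [U k] are nested, since the radius shrinks at
    each step by just the bound on the step; the supremum of the left ends lies in all of them. The
    explicit rate yields uniform convergence when [U] depends on a parameter. *)
Lemma nested_limit (U : R^nat) D : (forall k, `|U k.+1 - U k| <= D / 2 ^+ k) ->
  exists V, forall k, `|V - U k| <= 2 * D / 2 ^+ k.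
Proof.
move=> UD.
pose a k := U k - 2 * D / 2 ^+ k; pose b k := U k + 2 * D / 2 ^+ k.
have D0 : 0 <= D by have := le_trans (normr_ge0 _) (UD 0); rewrite expr0 divr1.
have p2 k : 0 < (2 ^+ k : R) by rewrite exprn_gt0.
have half k : D / 2 ^+ k.+1 = D / 2 ^+ k / 2.
  by rewrite exprS invfM; ring.
have a_nd : {homo a : k l / (k <= l)%N >-> k <= l}.
  apply: homo_leq => [//|? ? ?|k]; first exact: le_trans.
  have := UD k; rewrite ler_norml => /andP[+ _].
  by rewrite /a -!mulrA half; lra.
have b_ni : {homo b : k l / (k <= l)%N >-> l <= k}.
  apply: homo_leq => [//|? ? ? ? /le_trans|k]; first exact.
  have := UD k; rewrite ler_norml => /andP[_].
  by rewrite /b -!mulrA half; lra.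
have ab k l : a k <= b l.
  have /le_trans -> // := a_nd k (maxn k l) (leq_maxl _ _).
  apply: le_trans (b_ni l (maxn k l) (leq_maxr _ _)).
  rewrite /a /b lerD2l -subr_ge0 opprK addr_ge0//;
  by rewrite divr_ge0 ?mulr_ge0// ltW.
exists (sup (range a)) => k; rewrite ler_norml; apply/andP; split.
  have : a k <= sup (range a).
    apply: ub_le_sup; last by exists k.
    by exists (b 0) => _ [l _ <-].
  by rewrite /a; lra.
have : sup (range a) <= b k.
  by apply: ge_sup; [exists (a 0), 0|move=> _ [l _ <-]].
by rewrite /b; lra.
Qed.

(** Banach's fixed-point theorem with ratio 1/2 for the sup distance on the whole line. Limits are
    taken pointwise; their rate does not depend on [x], so the limit is continuous. The bound [D]
    keeps the distances between iterates finite. *)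
Lemma sup_contraction_fixpoint (T : (R -> R) -> R -> R) (u0 : R -> R) D :
  (forall u, continuous u -> continuous (T u)) ->
  (forall u v e, continuous u -> continuous v ->
    (forall x, `|u x - v x| <= e) -> forall x, `|T u x - T v x| <= e / 2) ->
  continuous u0 -> (forall x, `|T u0 x - u0 x| <= D) ->
  exists2 u, continuous u & forall x, T u x = u x.
Proof.
move=> Tc Tcontr u0c u0D.
pose U k := iter k T u0.
have Uc k : continuous (U k) by elim: k => //= k; exact: Tc.
have UD k x : `|U k.+1 x - U k x| <= D / 2 ^+ k.
  elim: k x => [|k IH] x; first by rewrite expr0 divr1; exact: u0D.
  by rewrite exprS invfM mulrCA mulrC; apply: (@Tcontr (U k.+1) (U k)).
have /choice[V VU] : forall x, exists V, forall k, `|V - U k x| <= 2 * D / 2 ^+ k.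
  by move=> x; apply: nested_limit => k.
have small e : 0 < e -> exists k, 2 * D / 2 ^+ k < e.
  move=> e0.
  have /cvgrPdist_lt /(_ e e0) [k _ /(_ k (leqnn k)) /=] :
      (2 * D) * 2^-1 ^+ k @[k --> \oo] --> (0 : R).
    rewrite -[X in _ --> X](mulr0 (2 * D)); apply: cvgMr.
    by apply: cvg_expr; rewrite gtr0_norm ?invr_gt0// invf_lt1// ltr1n.
  rewrite sub0r normrN exprVn => /ltr_normlW ?.
  by exists k.
have Vc : continuous V.
  move=> x; apply/cvgrPdist_lt => e e0.
  have e3 : 0 < e / 3 by rewrite divr_gt0.
  have [k ke] := small _ e3.
  have /cvgrPdist_lt /(_ _ e3) := Uc k x.
  apply: filterS => y xy.
  have -> : V x - V y = (V x - U k x) + (U k x - U k y) + (U k y - V y) by ring.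
  apply: le_lt_trans (ler_normD _ _) _.
  apply: (@le_lt_trans _ _ (`|V x - U k x| + `|U k x - U k y| + `|U k y - V y|)).
    by rewrite lerD2r ler_normD.
  have := VU x k; have := VU y k; rewrite distrC; move: xy ke; lra.
exists V => // x; apply/eqP; rewrite -subr_eq0 -normr_le0.
apply/ler_addgt0Pl => e e0; rewrite addr0.
have [k ke] := small _ e0.
have -> : T V x - V x = (T V x - U k.+1 x) + (U k.+1 x - V x) by ring.
apply: le_trans (ler_normD _ _) _.
have h1 : `|T V x - U k.+1 x| <= 2 * D / 2 ^+ k / 2 by apply: Tcontr.
have h2 : `|U k.+1 x - V x| <= 2 * D / 2 ^+ k / 2.
  by rewrite distrC; apply: le_trans (VU x _) _; rewrite exprS invfM; lra.
by move: h1 h2 ke; lra.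
Qed.

(** The integral is frozen outside [[c, d]], which makes it continuous on the whole line and
    determined by a compact interval. Working between [c - 1] and [d + 1] makes the fundamental
    theorem available at [c] and [d] too. *)
Lemma antiderivative f c d x0 : continuous f -> c < x0 < d ->
  exists G : R -> R, [/\ continuous G, G x0 = 0,
    (forall x, c < x < d -> is_derive x 1 G (f x)) &
    (forall x, G x = G (clamp c d x))].
Proof.
move=> fc /andP[cx0 x0d].
have cd : c <= d by rewrite ltW// (lt_trans cx0).
pose I x := (\int[lebesgue_measure]_(t in `[c - 1, x]) f t)%R.
have dI x : c <= x <= d -> is_derive x 1 I (f x).
  move=> /andP[cx xd].
  have xd1 : x < d + 1 by lra.
  have [||dIx E] := @continuous_FTC1_closed R f (c - 1) x (d + 1) xd1 _ _ (fc x).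
  - apply: continuous_compact_integrable; first exact: segment_compact.
    exact: continuous_subspaceT.
  - by lra.
  - by split => //; rewrite -derive1E.
exists (fun x => I (clamp c d x) - I (clamp c d x0)); split.
- move=> x; apply: (@continuousB _ _ _ (I \o clamp c d) (cst _)); last exact: cst_continuous.
  apply: continuous_comp; first exact: clamp_continuous.
  by apply: is_derive_continuous (dI _ _); exact: clamp_itv.
- by rewrite subrr.
- move=> x /andP[cx xd]; apply: (@is_derive_near (fun y => I y - I (clamp c d x0))).
    have xcd : x \in `]c, d[ by rewrite in_itv/= cx.
    near=> y; rewrite [in RHS]clamp_id//.
    have : y \in `]c, d[ by near: y; exact: near_in_itvoo.
    by rewrite in_itv/= => /andP[? ?]; rewrite !ltW.
  rewrite -[f x]subr0; apply: is_derive_funB.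
  by apply: dI; rewrite !ltW.
- by move=> x; rewrite (@clamp_id c d (clamp c d x))// clamp_itv.
Unshelve. all: by end_near. Qed.

Lemma antiderivative_bound (G h : R -> R) c d x0 e : c < x0 < d ->
  continuous G -> G x0 = 0 ->
  (forall x, c < x < d -> is_derive x 1 G (h x)) ->
  (forall x, G x = G (clamp c d x)) ->
  (forall x, `|h x| <= e) -> forall x, `|G x| <= (d - c) * e.
Proof.
move=> /andP[cx0 x0d] Gc Gx0 dG Gcl he x.
have e0 : 0 <= e by rewrite (le_trans _ (he 0)).
rewrite Gcl; set y := clamp c d x.
have /andP[cy yd] : c <= y <= d by rewrite clamp_itv// ltW// (lt_trans cx0).
have [x0y|/ltW yx0] := leP x0 y.
- have [||z] := @MVT_segment R G h _ _ x0y.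
  + by move=> z; rewrite in_itv/= => /andP[? ?]; apply: dG; lra.
  + exact: continuous_subspaceT.
  rewrite in_itv/= Gx0 subr0 => _ ->; rewrite normrM mulrC.
  by rewrite ler_pM// ger0_norm ?subr_ge0//; lra.
- have [||z] := @MVT_segment R G h _ _ yx0.
  + by move=> z; rewrite in_itv/= => /andP[? ?]; apply: dG; lra.
  + exact: continuous_subspaceT.
  rewrite in_itv/= Gx0 sub0r => _ E; rewrite -normrN E normrM mulrC.
  by rewrite ler_pM// ger0_norm ?subr_ge0//; lra.
Qed.

(* Picard iteration in one unknown: substituting the integral of the first
   equation into the second leaves a fixed-point problem for [v] alone. *)
Lemma ode_local_existence (f g : R -> R -> R) c d x0 a b K : c < x0 < d ->
  (forall u, continuous u -> continuous (fun x => f x (u x))) ->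
  (forall u, continuous u -> continuous (fun x => g x (u x))) ->
  (forall x y z, `|f x y - f x z| <= K * `|y - z|) ->
  (forall x y z, `|g x y - g x z| <= K * `|y - z|) ->
  K * (d - c) <= 2^-1 ->
  exists u v : R -> R, [/\ continuous u, continuous v, u x0 = a, v x0 = b &
    forall x, c < x < d ->
      is_derive x 1 u (f x (v x)) /\ is_derive x 1 v (g x (u x))].
Proof.
move=> cx0d fc gc fK gK Kcd.
have K0 : 0 <= K.
  by have := le_trans (normr_ge0 _) (fK 0 1 0); rewrite subr0 normr1 mulr1.
have dc0 : 0 <= d - c by move: cx0d; lra.
have /choice[A HA] : forall h : R -> R, exists G : R -> R, continuous h ->
    [/\ continuous G, G x0 = 0,
      (forall x, c < x < d -> is_derive x 1 G (h x)) &
      (forall x, G x = G (clamp c d x))].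
  move=> h; have [hc|nhc] := pselect (continuous h); last by exists (cst 0).
  by have [G HG] := antiderivative hc cx0d; exists G.
have A_lip h1 h2 e : continuous h1 -> continuous h2 ->
    (forall x, `|h1 x - h2 x| <= e) -> forall x, `|A h1 x - A h2 x| <= (d - c) * e.
  move=> c1 c2; have [A1 B1 C1 D1] := HA _ c1; have [A2 B2 C2 D2] := HA _ c2.
  move=> he; apply: (@antiderivative_bound (fun x => A h1 x - A h2 x)
    (fun x => h1 x - h2 x) _ _ x0) => //.
  - by move=> x; apply: (@continuousB _ _ _ (A h1) (A h2)); [exact: A1|exact: A2].
  - by rewrite B1 B2 subrr.
  - by move=> x cxd; apply: is_derive_funB; [exact: C1|exact: C2].
  - by move=> x; rewrite D1 D2.
pose U (v : R -> R) x := a + A (fun t => f t (v t)) x.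
pose T v x := b + A (fun t => g t (U v t)) x.
have Uc v : continuous v -> continuous (U v).
  move=> vc x; apply: (@continuousD _ _ _ (cst a)); first exact: cst_continuous.
  by have [Ac _ _ _] := HA _ (fc _ vc); exact: Ac.
have Tc v : continuous v -> continuous (T v).
  move=> vc x; apply: (@continuousD _ _ _ (cst b)); first exact: cst_continuous.
  by have [Ac _ _ _] := HA _ (gc _ (Uc _ vc)); exact: Ac.
have lip_comp k u v e : (forall x y z, `|k x y - k x z| <= K * `|y - z|) ->
    (forall x, `|u x - v x| <= e) ->
    forall x : R, `|k x (u x) - k x (v x)| <= K * e :> R.
  by move=> kK uv x; apply: le_trans (kK _ _ _) _; rewrite ler_wpM2l.
have Ulip v w e : continuous v -> continuous w -> (forall x, `|v x - w x| <= e) ->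
    forall x, `|U v x - U w x| <= (d - c) * (K * e).
  move=> vc wc vwe x; rewrite /U opprD addrACA subrr add0r.
  by apply: A_lip; [exact: fc|exact: fc|exact: lip_comp].
(* [T (cst b)] is constant outside [[c, d]], so its maximal distance from [b] on that interval
   bounds it everywhere. *)
have [D TD] : exists D, forall x, `|T (cst b) x - cst b x| <= D.
  have Tb := Tc _ (@cst_continuous _ _ b).
  have [_ _ _ Acl] := HA _ (gc _ (Uc _ (@cst_continuous _ _ b))).
  have [||y _ yM] := @EVT_max R (fun x => `|T (cst b) x - b|) c d.
  - by move: dc0; lra.
  - apply: continuous_subspaceT => x; apply: (@continuous_comp _ _ _ (fun y => T (cst b) y - b) (fun y : R => `|y|)); last exact: norm_continuous.
    by apply: (@continuousB _ _ _ (T (cst b)) (cst b)); [exact: Tb|exact: cst_continuous].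
  exists (`|T (cst b) y - b|) => x.
  have -> : T (cst b) x = T (cst b) (clamp c d x) by rewrite /T Acl.
  by apply: yM; rewrite in_itv/=; apply: clamp_itv; move: dc0; lra.
have [|v vc Tv] := @sup_contraction_fixpoint T (cst b) D Tc _ (@cst_continuous _ _ b) TD.
  move=> v w e vc wc vwe x.
  have e0 : 0 <= e by rewrite (le_trans _ (vwe 0)).
  rewrite /T opprD addrACA subrr add0r.
  (* Each of the two nested integrations contributes a factor [K * (d - c)], at most 1/2; the
     product is at most 1/4. *)
  apply: (@le_trans _ _ ((d - c) * (K * ((d - c) * (K * e))))).
    apply: A_lip; [exact/gc/Uc|exact/gc/Uc|].
    by apply: lip_comp => //; exact: Ulip.
  have -> : (d - c) * (K * ((d - c) * (K * e))) = (K * (d - c)) ^+ 2 * e by ring.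
  rewrite mulrC ler_wpM2l//.
  have : 0 <= K * (d - c) by rewrite mulr_ge0.
  by move: Kcd; nra.
have [_ A1 A2 _] := HA _ (fc _ vc).
have [_ B1 B2 _] := HA _ (gc _ (Uc _ vc)).
exists (U v), v; split => //.
- exact: Uc.
- by rewrite /U A1 addr0.
- by rewrite -Tv /T B1 addr0.
move=> x cxd; split.
  by rewrite -[f _ _]add0r; apply: is_derive_funD; exact: A2.
have -> : v = T v by apply/funext => y; rewrite Tv.
rewrite -[g _ _]add0r; apply: is_derive_funD.
have -> : T v = v by apply/funext => y; rewrite Tv.
exact: B2.
Qed.

End Calculus.

(** * The equation of state as a function of the enthalpy *)

Section EquationOfState.
Local Open Scope classical_set_scope.
Local Open Scope ring_scope.
Variables (R : realType) (rho Pe : R -> R).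
Implicit Types (a b e p : R).
Hypothesis eos : barotropic_eos rho Pe.
Hypothesis rhoD : forall e : R, 0 < e -> derivable (rho_eta rho Pe) e 1.

Let eta := eta_of rho.
Let PeK p : 0 <= p -> Pe (eta p) = p. Proof. by case: eos => _ _ + _; exact. Qed.
Let etaK e : 0 <= e -> eta (Pe e) = e.
Proof. by case: eos => _ _ _ /[apply] -[]. Qed.
Let Pe_ge0 e : 0 <= e -> 0 <= Pe e.
Proof. by case: eos => _ _ _ /[apply] -[]. Qed.

Lemma eta_of0 : eta_of rho 0 = 0.
Proof. by rewrite /eta_of set_itv_ge ?integral_set0// bnd_simp ltxx. Qed.

Lemma Pe0 : Pe 0 = 0.
Proof. by rewrite -[X in Pe X]eta_of0; exact: PeK. Qed.

(** Weak monotonicity comes from the nonnegative integrand, strictness from injectivity: [Pe] is a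
    left inverse. *)
Lemma eta_of_lt a b : 0 <= a -> a < b -> eta_of rho a < eta_of rho b.
Proof.
move=> a0 ab; have b0 := le_lt_trans a0 ab.
rewrite lt_neqAle; apply/andP; split.
  by apply: contra_ltN ab => /eqP ab; rewrite -(PeK a0) -(PeK (ltW b0)) /eta ab.
have [rho0 irho _ _] := eos.
have nneg (x : R) : `]0, b]%classic x -> (0 <= ((rho x)^-1)%:E)%E.
  by rewrite /= in_itv/= => /andP[x0 _]; rewrite lee_fin invr_ge0 ltW// rho0.
have sub : `]0, a]%classic `<=` `]0, b]%classic by apply: subset_itvl; rewrite bnd_simp ltW.
have iab := irho _ b0.
have /integrableP[mb _] := iab.
apply: fine_le.
- by apply: integrable_fin_num => //; exact: integrableS iab.
- exact: integrable_fin_num.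
- exact: ge0_subset_integral.
Qed.

Lemma eta_of_gt0 p : 0 < p -> 0 < eta_of rho p.
Proof. by move=> p0; rewrite -eta_of0; exact: eta_of_lt. Qed.

Lemma Pe_lt a b : 0 <= a -> a < b -> Pe a < Pe b.
Proof.
move=> a0 ab; have b0 := le_lt_trans a0 ab.
rewrite ltNge le_eqVlt; apply/negP => /predU1P[E|ba].
  by move: ab; rewrite -(etaK a0) -E etaK ?ltxx// ltW.
have := eta_of_lt (Pe_ge0 (ltW b0)) ba.
by rewrite -/eta !etaK ?(ltW b0)// ltNge (ltW ab).
Qed.

Lemma Pe_gt0 e : 0 < e -> 0 < Pe e.
Proof. by move=> e0; rewrite -Pe0; exact: Pe_lt. Qed.

(** An increasing function that maps an interval onto an interval is continuous; [Pe] supplies the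
    preimages. *)
Lemma eta_of_continuous p : 0 < p -> {for p, continuous (eta_of rho)}.
Proof.
move=> p0; have q0 : 0 <= p + 1 by lra.
have mono : {in `[0, p + 1] &, {mono eta_of rho : x y / x <= y}}.
  apply: le_mono_in => x y; rewrite !in_itv/= => /andP[x0 _] _.
  exact: eta_of_lt.
have surj : set_surj `[0, p + 1] `[eta_of rho 0, eta_of rho (p + 1)] (eta_of rho).
  move=> e; rewrite eta_of0 /= in_itv/= => /andP[e0 ep].
  exists (Pe e); last exact: etaK.
  rewrite /= in_itv/= Pe_ge0//= -[leRHS]PeK//.
  by move: ep; rewrite le_eqVlt => /predU1P[->//|?]; rewrite ltW// Pe_lt.
have := segment_inc_surj_continuous mono surj.
have p1 : 0 < p + 1 by lra.
move/(continuous_within_itvP _ p1) => -[+ _ _]; apply.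
by rewrite in_itv/= p0; lra.
Qed.

Lemma rho_eta_eta_of p : 0 < p -> rho_eta rho Pe (eta_of rho p) = rho p.
Proof. by move=> p0; rewrite /rho_eta /= PeK// ltW. Qed.

(** Smoothness is assumed of the density as a function of the enthalpy; composition with the
    continuous [eta_of rho] transfers continuity to the density as a function of the pressure, as
    the fundamental theorem requires below. *)
Lemma rho_continuous p : 0 < p -> {for p, continuous rho}.
Proof.
move=> p0.
have E : \near p, (rho_eta rho Pe \o eta_of rho) p = rho p.
  near=> q; apply: rho_eta_eta_of; near: q; exact: lt_nbhsr.
apply: cvg_trans; first exact: near_eq_cvg E.
rewrite -(rho_eta_eta_of p0).
apply: (@continuous_comp _ _ _ (eta_of rho)); first exact: eta_of_continuous.
apply/differentiable_continuous/derivable1_diffP.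
exact/rhoD/eta_of_gt0.
Unshelve. all: by end_near. Qed.

Lemma is_derive_eta_of p : 0 < p -> is_derive p 1 (eta_of rho) (rho p)^-1.
Proof.
move=> p0; have [rho0 irho _ _] := eos.
have p1 : p < p + 1 by lra.
have [|||d E] := @continuous_FTC1 R (fun x => (rho x)^-1) (BRight 0) p (p + 1) p1 (irho _ _) _ _.
- by lra.
- by rewrite lte_fin.
- by apply: cvgV; [rewrite gt_eqF// rho0|exact: rho_continuous].
- by split => //; rewrite -derive1E.
Qed.

(** The rule for inverse functions: the enthalpy has derivative [1 / rho] in the pressure. *)
Lemma is_derive_Pe e : 0 < e -> is_derive e 1 Pe (rho_eta rho Pe e).
Proof.
move=> e0; have [rho0 irho _ _] := eos.
rewrite -[X in is_derive X]etaK ?ltW//.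
rewrite -[rho_eta _ _ _]invrK; apply: is_derive_inverse.
- near=> p; apply: PeK; apply: ltW; near: p; exact/lt_nbhsr/Pe_gt0.
- near=> p; apply: eta_of_continuous; near: p; exact/lt_nbhsr/Pe_gt0.
- exact/is_derive_eta_of/Pe_gt0.
- by rewrite invr_neq0// gt_eqF// rho0// Pe_gt0.
Unshelve. all: by end_near. Qed.

Lemma Pe_small e : 0 < e -> exists2 d, 0 < d & forall x, 0 < x < d -> 0 < Pe x < e.
Proof.
move=> e0; exists (eta_of rho e); first exact: eta_of_gt0.
move=> x /andP[x0 xe]; rewrite Pe_gt0//= -[ltRHS]PeK ?ltW//.
by apply: Pe_lt => //; exact: ltW.
Qed.

End EquationOfState.

(** * Nonexistence of solutions of infinite radius *)

Section GlobalSolutions.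
Local Open Scope classical_set_scope.
Local Open Scope ring_scope.
Variables (R : realType) (rh drh P : R -> R).
Implicit Types (a b e r s x : R).
Hypothesis rh_gt0 : forall e, 0 < e -> 0 < rh e.
Hypothesis rhD : forall e, 0 < e -> is_derive e 1 rh (drh e).
Hypothesis drh_ge0 : forall e, 0 < e -> 0 <= drh e.
Hypothesis drh_le : forall e, 0 < e -> e * drh e <= 5 * rh e.
Hypothesis drh_lt : exists2 d, 0 < d & forall e, 0 < e < d -> e * drh e < 5 * rh e.
Hypothesis P_gt0 : forall e, 0 < e -> 0 < P e.
Hypothesis PD : forall e, 0 < e -> is_derive e 1 P (rh e).
Hypothesis P_small : forall e, 0 < e ->
  exists2 d, 0 < d & forall x, 0 < x < d -> 0 < P x < e.

(** * Comparison of density, pressure and powers of the enthalpy *)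

Lemma rh_ndecr a b : 0 < a -> a <= b -> rh a <= rh b.
Proof.
move=> a0 ab; apply: (@is_derive_ndecr _ _ drh _ _ ab) => x /andP[ax _].
- by apply: rhD; exact: lt_le_trans ax.
- by apply: drh_ge0; exact: lt_le_trans ax.
Qed.

(** Replaces a boundary value at 0, where [F] carries no information: a lower limit at least 0 there
    is enough. *)
Lemma ndecr_nonneg (F : R -> R) x :
  (forall a b, 0 < a -> a <= b -> F a <= F b) ->
  (forall e, 0 < e -> exists2 d, 0 < d & forall y, 0 < y < d -> - e <= F y) ->
  0 < x -> 0 <= F x.
Proof.
move=> Fnd F0 x0; apply/ler_addgt0Pl => e e0.
have [d d0 Fd] := F0 _ e0.
pose y := Num.min x (d / 2).
have y0 : 0 < y by rewrite lt_min x0 divr_gt0.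
have yx : y <= x by rewrite ge_min lexx.
have yd : y < d.
  by apply: (@le_lt_trans _ _ (d / 2)); [rewrite ge_min lexx orbT|lra].
have := Fd y; rewrite y0 yd => /(_ isT).
by have := Fnd _ _ y0 yx; lra.
Qed.

Lemma P_le_rh e : 0 < e -> P e <= e * rh e.
Proof.
move=> e0; rewrite -subr_ge0.
apply: (@ndecr_nonneg (fun x => x * rh x - P x)) => // [a b a0 ab|d d0].
  apply: (@is_derive_ndecr _ (fun x => x * rh x - P x) (fun x => x * drh x + rh x * 1 - rh x) _ _ ab) => x /andP[ax _];
    have x0 : 0 < x by exact: lt_le_trans ax.
  - apply: is_derive_funB; last exact: PD.
    by apply: is_derive_funM; exact: rhD.
  - by have := mulr_ge0 (ltW x0) (drh_ge0 x0); lra.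
have [c c0 Pc] := P_small d0; exists c => // y yc.
have [y0 _] := andP yc.
by have := Pc _ yc; have := mulr_gt0 y0 (rh_gt0 y0); lra.
Qed.

(** The difference [F] has derivative [rho (5 - n)] and is nonnegative near 0 up to any error, hence
    nonnegative. It is strictly positive because [n < 5] holds for small enthalpy. *)
Lemma rh_lt_P e : 0 < e -> e * rh e < 6 * P e.
Proof.
pose F x := 6 * P x - x * rh x.
have FD x : 0 < x -> is_derive x 1 F (5 * rh x - x * drh x).
  move=> x0.
  have -> : 5 * rh x - x * drh x = 6 * rh x + P x * 0 - (x * drh x + rh x * 1) by ring.
  apply: is_derive_funB; last by apply: is_derive_funM; exact: rhD.
  by apply: is_derive_funM; exact: PD.
have Fnd a b : 0 < a -> a <= b -> F a <= F b.
  move=> a0 ab; apply: (@is_derive_ndecr _ F (fun x => 5 * rh x - x * drh x) _ _ ab) => x /andP[ax _].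
    by apply: FD; exact: lt_le_trans ax.
  by rewrite subr_ge0 drh_le//; exact: lt_le_trans ax.
have F_ge0 x : 0 < x -> 0 <= F x.
  apply: ndecr_nonneg => // d d0.
  have r1 := rh_gt0 ltr01.
  (* For [y] below this bound, [y * rh y <= y * rh 1 < d]. *)
  exists (Num.min 1 (d / rh 1)); first by rewrite lt_min ltr01 divr_gt0.
  move=> y /andP[y0]; rewrite lt_min => /andP[y1]; rewrite ltr_pdivlMr// => yd.
  have := P_gt0 y0; have := rh_ndecr y0 (ltW y1).
  by rewrite -(ler_pM2l y0) /F; lra.
move=> e0; rewrite -subr_gt0 -/(F e).
have [d d0 dlt] := drh_lt.
pose y := Num.min e (d / 2).
have y0 : 0 < y by rewrite lt_min e0 divr_gt0.
have ye : y <= e by rewrite ge_min lexx.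
have yd : y < d.
  by apply: (@le_lt_trans _ _ (d / 2)); [rewrite ge_min lexx orbT|lra].
apply: lt_le_trans (Fnd _ _ y0 ye).
(* On [[y / 2, y]], which lies in the range where [n < 5], [F] increases strictly. *)
have y20 : 0 < y / 2 by lra.
apply: le_lt_trans (F_ge0 _ y20) _.
apply: (@is_derive_incr _ F (fun x => 5 * rh x - x * drh x)).
- by lra.
- by move=> x /andP[yx _]; apply: FD; lra.
- by move=> x /andP[yx xy]; rewrite subr_gt0 dlt//; lra.
Qed.

(** The logarithmic derivative of the quotient in [ln e] is [n - 5]. *)
Lemma rh_div5_nincr a b : 0 < a -> a <= b -> rh b / b ^+ 5 <= rh a / a ^+ 5.
Proof.
move=> a0 ab.
suff : 0 - rh a / a ^+ 5 <= 0 - rh b / b ^+ 5 by lra.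
apply: (@is_derive_ndecr _ (fun x => 0 - rh x / x ^+ 5)
  (fun x => (5 * rh x - x * drh x) / x ^+ 6) _ _ ab) => x /andP[ax _];
  have x0 : 0 < x by exact: lt_le_trans ax.
- have -> : (5 * rh x - x * drh x) / x ^+ 6 =
    0 - (rh x * (- (x ^+ 5) ^- 2 * (5%:R * x ^+ 4 * 1)) + (x ^+ 5)^-1 * drh x).
    by field; rewrite gt_eqF.
  apply: is_derive_funB; apply: is_derive_funM; first exact: rhD.
  apply: is_derive_funV; first by rewrite expf_neq0// gt_eqF.
  exact: is_derive_funX.
- by rewrite divr_ge0 ?exprn_ge0 ?(ltW x0)// subr_ge0 drh_le.
Qed.

Lemma P_le_pow6 L e : (forall x, 0 < x -> rh x <= L * x ^+ 5) ->
  0 < e -> P e <= L * e ^+ 6 / 6.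
Proof.
move=> rhL e0; rewrite -subr_ge0.
have L0 : 0 <= L.
  by have := rhL 1 ltr01; rewrite expr1n mulr1; apply: le_trans; exact/ltW/rh_gt0.
apply: (@ndecr_nonneg (fun x => L * x ^+ 6 / 6 - P x)) => // [a b a0 ab|d d0].
  apply: (@is_derive_ndecr _ (fun x => L * x ^+ 6 / 6 - P x) (fun x => L * x ^+ 5 - rh x) _ _ ab) => x /andP[ax _];
    have x0 : 0 < x by exact: lt_le_trans ax.
  - have -> : L * x ^+ 5 - rh x =
      L * x ^+ 6 * 0 + 6^-1 * (L * (6%:R * x ^+ 5 * 1) + x ^+ 6 * 0) - rh x by field.
    apply: is_derive_funB; last exact: PD.
    by do 2!apply: is_derive_funM; exact: is_derive_funX.
  - by rewrite subr_ge0 rhL.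
have [c c0 Pc] := P_small d0; exists c => // y yc.
have [y0 _] := andP yc.
have : 0 <= L * y ^+ 6 by rewrite mulr_ge0// exprn_ge0// ltW.
by have := Pc _ yc; lra.
Qed.

(** * Monotone quantities along a solution that exists for all [r > r0] *)

Section Star.
Variables (r0 : R) (m u : R -> R).
Hypothesis r0_ge0 : 0 <= r0.
Hypothesis u_gt0 : forall r, r0 < r -> 0 < u r.
Hypothesis mD : forall r, r0 < r -> is_derive r 1 m (4 * pi * r ^+ 2 * rh (u r)).
Hypothesis uD : forall r, r0 < r -> is_derive r 1 u (- m r / r ^+ 2).

Let r_gt0 r : r0 < r -> 0 < r. Proof. exact: le_lt_trans. Qed.

(* In terms of [u' = - m / r^2]: [r^3 u'^2 / 2 + 4 pi r^3 P + r^2 u u' / 2]. *)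
Definition pohozaev r :=
  m r ^+ 2 / (2 * r) + 4 * pi * r ^+ 3 * P (u r) - m r * u r / 2.

Lemma is_derive_pohozaev r : r0 < r ->
  is_derive r 1 pohozaev (2 * pi * r ^+ 2 * (6 * P (u r) - u r * rh (u r))).
Proof.
move=> rr0; have rgt0 := r_gt0 rr0; have r_neq0 : r != 0 by rewrite gt_eqF.
have r2_neq0 : 2 * r != 0 by rewrite mulf_neq0.
have mr := mD rr0; have ur := uD rr0.
have Pr : is_derive r 1 (fun s => P (u s)) (rh (u r) * (- m r / r ^+ 2)).
  by apply: is_derive1_comp; exact/PD/u_gt0.
have H1 := is_derive_funM (is_derive_funX 2 mr)
  (is_derive_funV (f := fun s => 2 * s) r2_neq0
    (is_derive_funM (is_derive_funC 2 r) (is_derive_id r (1 : R)))).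
have H2 := is_derive_funM (is_derive_funM (is_derive_funC (4 * pi) r)
  (is_derive_funX 3 (is_derive_id r (1 : R)))) Pr.
have H3 := is_derive_funM (is_derive_funM mr ur) (is_derive_funC 2^-1 r).
apply: (is_derive_eq (is_derive_funB (is_derive_funD H1 H2) H3)).
by rewrite /=; field.
Qed.

Lemma pohozaev_ndecr a b : r0 < a -> a <= b -> pohozaev a <= pohozaev b.
Proof.
move=> ra ab.
have abr x : a <= x <= b -> r0 < x by case/andP => ax _; exact: lt_le_trans ax.
apply: (@is_derive_ndecr _ pohozaev _ _ _ ab) => x /abr rx /=; first exact: is_derive_pohozaev.
rewrite mulr_ge0 ?subr_ge0 ?(ltW (rh_lt_P (u_gt0 rx)))//.
by rewrite !(sqr_ge0, pi_ge0, mulr_ge0).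
Qed.

Lemma pohozaev_incr a b : r0 < a -> a < b -> pohozaev a < pohozaev b.
Proof.
move=> ra ab.
have abr x : a <= x <= b -> r0 < x by case/andP => ax _; exact: lt_le_trans ax.
apply: (@is_derive_incr _ pohozaev _ _ _ ab) => x /abr rx /=; first exact: is_derive_pohozaev.
rewrite mulr_gt0 ?subr_gt0 ?rh_lt_P ?u_gt0//.
by rewrite !mulr_gt0 ?pi_gt0 ?exprn_gt0 ?(r_gt0 rx).
Qed.

Lemma mass_ndecr a b : r0 < a -> a <= b -> m a <= m b.
Proof.
move=> ra ab.
have abr x : a <= x <= b -> r0 < x by case/andP => ax _; exact: lt_le_trans ax.
apply: (@is_derive_ndecr _ m _ _ _ ab) => x /abr rx /=; first exact: mD.
by rewrite !(sqr_ge0, pi_ge0, mulr_ge0)// ltW// rh_gt0 ?u_gt0.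
Qed.

(** If the mass stayed nonpositive, [u] would be nondecreasing, so [m'] would stay above a positive
    constant [c] and the mass would grow linearly past 0. *)
Lemma mass_eventually_gt0 : exists2 r, r0 < r & 0 < m r.
Proof.
apply: contrapT => noex.
have m_le0 r : r0 < r -> m r <= 0.
  by move=> rr; rewrite leNgt; apply/negP => mr; apply: noex; exists r.
pose a := r0 + 1.
have ra : r0 < a by rewrite ltrDl.
have a0 := r_gt0 ra.
have ua x : a <= x -> u a <= u x.
  move=> ax; apply: (@is_derive_ndecr _ u _ _ _ ax) => y /andP[ay _];
    have ry := lt_le_trans ra ay.
    exact: uD.
  by rewrite divr_ge0 ?sqr_ge0// oppr_ge0 m_le0.
pose c := 4 * pi * a ^+ 2 * rh (u a).
have c0 : 0 < c by rewrite !mulr_gt0 ?pi_gt0 ?exprn_gt0 ?rh_gt0 ?u_gt0.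
(* The linear lower bound with slope [c] reaches 1 at [b]. *)
pose b := a + (1 - m a) / c.
have ab : a <= b by rewrite lerDl divr_ge0 ?(ltW c0)// subr_ge0 (le_trans (m_le0 _ ra)).
suff : m a - c * a <= m b - c * b.
  have rb := lt_le_trans ra ab; have := m_le0 _ rb.
  have : c * b = c * a + (1 - m a) by rewrite /b; field; rewrite gt_eqF.
  by lra.
apply: (@is_derive_ndecr _ (fun x => m x - c * x)
  (fun x => 4 * pi * x ^+ 2 * rh (u x) - (c * 1 + x * 0)) _ _ ab) => x /andP[ax _];
  have rx := lt_le_trans ra ax.
- by apply: is_derive_funB; exact: mD.
- rewrite mulr0 addr0 mulr1 subr_ge0 /c ler_pM//.
  + by rewrite !(sqr_ge0, pi_ge0, mulr_ge0).
  + by rewrite ltW// rh_gt0 ?u_gt0.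
  + by rewrite ler_wpM2l ?mulr_ge0 ?pi_ge0// lerXn2r// nnegrE ltW// (r_gt0 rx, a0).
  + by apply: rh_ndecr; [exact: u_gt0|exact: ua].
Qed.

(** * Estimates beyond a radius [r1] of positive mass *)

Section PositiveMass.
Variable r1 : R.
Hypothesis r01 : r0 < r1.
Hypothesis m1_gt0 : 0 < m r1.

Let r1_gt0 : 0 < r1. Proof. exact: r_gt0. Qed.

Lemma mass_gt0 r : r1 <= r -> 0 < m r.
Proof. by move=> r1r; apply: lt_le_trans m1_gt0 _; exact: mass_ndecr. Qed.

Lemma potential_nincr a b : r1 <= a -> a <= b -> u b <= u a.
Proof.
move=> ra ab; suff : 0 - u a <= 0 - u b by lra.
apply: (@is_derive_ndecr _ (fun x => 0 - u x) (fun x => 0 - (- m x / x ^+ 2)) _ _ ab) => x /andP[ax _];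
  have rx := le_trans ra ax.
- by apply: is_derive_funB; apply: uD; exact: lt_le_trans rx.
- by rewrite sub0r mulNr opprK divr_ge0 ?sqr_ge0// ltW// mass_gt0.
Qed.

(** The mass does not decrease, so [u] lies below the vacuum potential of the mass [m r] continued
    from [r]. If [m r > r * u r], that potential reaches 0 at a finite radius, against [u > 0]. *)
Lemma mass_le r : r1 <= r -> m r <= r * u r.
Proof.
move=> r1r; have rgt0 := lt_le_trans r1_gt0 r1r; have mr := mass_gt0 r1r.
rewrite leNgt; apply/negP => umr.
have dlt : 0 < m r - r * u r by rewrite subr_gt0.
(* The zero of [u r - m r / r + m r / s]. *)
pose s := r * m r / (m r - r * u r).
have rs : r <= s.
  rewrite /s -mulrA ler_pMr// ler_pdivlMr// mul1r gerBl.
  by rewrite mulr_ge0 ?ltW ?u_gt0// (lt_le_trans r01).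
have s0 := lt_le_trans rgt0 rs.
suff : u s - m r / s <= u r - m r / r.
  have us : 0 < u s by rewrite u_gt0// (lt_le_trans r01)// (le_trans r1r).
  have -> : m r / s = m r / r - u r by rewrite /s; field; rewrite !gt_eqF.
  by lra.
suff : m r / r - u r <= m r / s - u s by lra.
apply: (@is_derive_ndecr _ (fun x => m r * x^-1 - u x)
  (fun x => (m r * (- x ^- 2 * 1) + x^-1 * 0) - (- m x / x ^+ 2)) _ _ rs) => x /andP[rx _];
  have x0 := lt_le_trans rgt0 rx.
- apply: is_derive_funB; last by apply: uD; rewrite (lt_le_trans r01)// (le_trans r1r).
  by apply: is_derive_funM; apply: (@is_derive_funV _ id); rewrite gt_eqF.
- have -> : (m r * (- x ^- 2 * 1) + x^-1 * 0) - (- m x / x ^+ 2) = (m x - m r) / x ^+ 2.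
    by field; rewrite gt_eqF.
  rewrite divr_ge0 ?sqr_ge0// subr_ge0 mass_ndecr//; exact: lt_le_trans r1r.
Qed.

(** The density does not increase outward, so the shell from [r1] to [r] has density at least
    [c = rh (u r)] and mass at least [4/3 pi c (r^3 - r1^3)]. As [r1 <= r / 2], this is at least
    [7/6 pi c r^3]. *)
Lemma mass_ge r : 2 * r1 <= r -> pi * r ^+ 3 * rh (u r) <= m r.
Proof.
move=> r1r; have r1r' : r1 <= r by move: r1_gt0 r1r; lra.
have c0 : 0 < rh (u r) by rewrite rh_gt0// u_gt0// (lt_le_trans r01).
set c := rh (u r) in c0 *.
have p0 := pi_gt0 R.
suff : m r1 - 4 / 3 * pi * c * r1 ^+ 3 <= m r - 4 / 3 * pi * c * r ^+ 3.
  have : r1 ^+ 3 <= r ^+ 3 / 8.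
    have -> : r ^+ 3 / 8 = (r / 2) ^+ 3 by field.
    by rewrite lerXn2r ?nnegrE//; move: r1_gt0; lra.
  have pc : 0 < pi * c by rewrite mulr_gt0.
  rewrite -(ler_pM2l pc); move: m1_gt0.
  have : 0 <= pi * c * r ^+ 3 by rewrite mulr_ge0 ?(ltW pc)// exprn_ge0//; move: r1_gt0; lra.
  have -> : pi * r ^+ 3 * c = pi * c * r ^+ 3 by ring.
  have E x : 4 / 3 * pi * c * x = 4 / 3 * (pi * c * x) by ring.
  by rewrite !E mulrA; lra.
apply: (@is_derive_ndecr _ (fun x => m x - 4 / 3 * pi * c * x ^+ 3)
  (fun x => 4 * pi * x ^+ 2 * rh (u x)
     - (4 / 3 * pi * c * (3%:R * x ^+ 2 * 1) + x ^+ 3 * 0)) _ _ r1r') => x /andP[rx xr].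
- apply: is_derive_funB; first by apply: mD; exact: lt_le_trans rx.
  by apply: is_derive_funM; exact: is_derive_funX.
- have -> : 4 * pi * x ^+ 2 * rh (u x)
     - (4 / 3 * pi * c * (3%:R * x ^+ 2 * 1) + x ^+ 3 * 0)
     = 4 * pi * x ^+ 2 * (rh (u x) - c) by field.
  rewrite !(sqr_ge0, pi_ge0, mulr_ge0)// subr_ge0 rh_ndecr ?potential_nincr//.
  by rewrite u_gt0// (lt_le_trans r01).
Qed.

Lemma density_le r : 2 * r1 <= r -> pi * r ^+ 2 * rh (u r) <= u r.
Proof.
move=> r1r; have r1r' : r1 <= r by move: r1_gt0 r1r; lra.
have rgt0 := lt_le_trans r1_gt0 r1r'.
rewrite -(ler_pM2l rgt0); apply: le_trans (mass_le r1r').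
by apply: le_trans (mass_ge r1r); rewrite le_eqVlt; apply/orP; left; apply/eqP; ring.
Qed.

(** If [u] stayed above [e], then [density_le] would bound [pi r^2 rh e] by [u r1] for all large
    [r]. *)
Lemma potential_small e : 0 < e -> exists2 r, 2 * r1 <= r & u r < e.
Proof.
move=> e0; apply: contrapT => noex.
have ue r : 2 * r1 <= r -> e <= u r.
  by move=> r1r; rewrite leNgt; apply/negP => ur; apply: noex; exists r.
have c0 : 0 < pi * rh e by rewrite mulr_gt0 ?pi_gt0 ?rh_gt0.
have u1 : 0 < u r1 by exact: u_gt0.
(* The first term puts [r] in the range of [density_le], the second gives [r <= r^2], the third
   makes [pi * rh e * r] exceed [u r1]. *)
pose r := 2 * r1 + 1 + u r1 / (pi * rh e).
have q0 : 0 < u r1 / (pi * rh e) by rewrite divr_gt0.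
have r1r : 2 * r1 <= r by rewrite /r; lra.
have rge1 : 1 <= r by rewrite /r; move: r1_gt0; lra.
have : u r1 < pi * r ^+ 2 * rh (u r).
  apply: (@lt_le_trans _ _ (pi * rh e * r)).
    by rewrite mulrC -ltr_pdivrMr// /r; move: r1_gt0; lra.
  apply: (@le_trans _ _ (pi * rh e * r ^+ 2)).
    by rewrite ler_pM2l// expr2 ler_peMl//; lra.
  rewrite mulrAC ler_wpM2l// ?rh_ndecr ?ue//.
  by rewrite !(sqr_ge0, pi_ge0, mulr_ge0).
apply/negP; rewrite -leNgt; apply: le_trans (density_le r1r) _.
by apply: potential_nincr => //; move: r1_gt0; rewrite /r; lra.
Qed.

(** The two terms containing the mass combine to [- m (r u - m) / (2 r)], which [mass_le] makes
    nonpositive. *)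
Lemma pohozaev_le r : r1 <= r -> pohozaev r <= 4 * pi * r ^+ 3 * P (u r).
Proof.
move=> r1r; have rgt0 := lt_le_trans r1_gt0 r1r.
have -> : pohozaev r =
    4 * pi * r ^+ 3 * P (u r) - m r * (r * u r - m r) / (2 * r).
  by rewrite /pohozaev; field; rewrite gt_eqF.
rewrite gerBl divr_ge0 ?mulr_ge0 ?(ltW rgt0)//; first exact/ltW/mass_gt0.
by rewrite subr_ge0 mass_le.
Qed.

Lemma pohozaev_le_sq r : 2 * r1 <= r -> pohozaev r <= 4 * (r * u r ^+ 2).
Proof.
move=> r1r; have r1r' : r1 <= r by move: r1_gt0 r1r; lra.
have rgt0 := lt_le_trans r1_gt0 r1r'.
have u0 : 0 < u r by rewrite u_gt0// (lt_le_trans r01).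
apply: le_trans (pohozaev_le r1r') _.
apply: (@le_trans _ _ (4 * pi * r ^+ 3 * (u r * rh (u r)))).
  rewrite ler_wpM2l ?P_le_rh//.
  by rewrite !mulr_ge0 ?pi_ge0 ?exprn_ge0 ?(ltW rgt0).
have -> : 4 * pi * r ^+ 3 * (u r * rh (u r)) =
  4 * r * u r * (pi * r ^+ 2 * rh (u r)) by ring.
have -> : 4 * (r * u r ^+ 2) = 4 * r * u r * u r by ring.
by rewrite ler_wpM2l ?density_le// !mulr_ge0 ?(ltW rgt0) ?(ltW u0).
Qed.

(* The derivative of [1 / (r u^2)] with respect to [ln r]. *)
Definition slope r := (2 * m r - r * u r) / (r ^+ 2 * u r ^+ 3).

Lemma is_derive_slope r : r0 < r -> is_derive r 1 slope
  ((8 * pi * r ^+ 4 * (u r * rh (u r)) + (r * u r) ^+ 2 - 6 * m r * (r * u r)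
     + 6 * m r ^+ 2) / (r ^+ 4 * u r ^+ 4)).
Proof.
move=> rr0; have rgt0 := r_gt0 rr0; have r_neq0 : r != 0 by rewrite gt_eqF.
have u_neq0 : u r != 0 by rewrite gt_eqF// u_gt0.
have mr := mD rr0; have ur := uD rr0; have ir := is_derive_id r (1 : R).
have D_neq0 : r ^+ 2 * u r ^+ 3 != 0 by rewrite mulf_neq0// expf_neq0.
have H1 := is_derive_funB (is_derive_funM (is_derive_funC 2 r) mr)
  (is_derive_funM ir ur).
have H2 := is_derive_funM (is_derive_funX 2 ir) (is_derive_funX 3 ur).
apply: (is_derive_eq (is_derive_funM H1 (is_derive_funV (f := fun s => s ^+ 2 * u s ^+ 3) D_neq0 H2))).
by rewrite /=; field; rewrite u_neq0.
Qed.

(** From [0 < m <= r u] follows [|2 m - r u| <= r u]. *)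
Lemma slope_bound r : r1 <= r -> `|slope r| <= (r * u r ^+ 2)^-1.
Proof.
move=> r1r; have rgt0 := lt_le_trans r1_gt0 r1r.
have u0 : 0 < u r by rewrite u_gt0// (lt_le_trans r01).
have D0 : 0 < r ^+ 2 * u r ^+ 3 by rewrite mulr_gt0// exprn_gt0.
have -> : (r * u r ^+ 2)^-1 = (r * u r) / (r ^+ 2 * u r ^+ 3).
  by field; rewrite !gt_eqF.
rewrite /slope normrM (gtr0_norm (x := _^-1)) ?invr_gt0//.
rewrite ler_pM2r ?invr_gt0// ler_norml.
have := mass_gt0 r1r; have := mass_le r1r.
by move=> ? ?; apply/andP; split; lra.
Qed.

Lemma global_pohozaev_le0 r : r0 < r -> pohozaev r <= 0.
Proof.
move=> rr0; rewrite leNgt; apply/negP => Q0.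
set q := pohozaev r in Q0.
pose a := Num.max r (2 * r1).
have ra : r <= a by rewrite le_max lexx.
have r1a : 2 * r1 <= a by rewrite le_max lexx orbT.
have a1 s : a <= s -> 2 * r1 <= s by exact: le_trans.
have a1' s : a <= s -> r1 <= s by move/a1; move: r1_gt0; lra.
have ar0 s : a <= s -> r0 < s by move/a1'; exact: lt_le_trans.
have agt0 s : a <= s -> 0 < s by move/ar0; exact: r_gt0.
have au0 s : a <= s -> 0 < u s by move/ar0; exact: u_gt0.
have qQ s : a <= s -> q <= pohozaev s.
  by move=> as_; apply: pohozaev_ndecr => //; exact: le_trans as_.
have w_ge s : a <= s -> q / 4 <= s * u s ^+ 2.
  by move=> as_; have := qQ _ as_; have := pohozaev_le_sq (a1 _ as_); lra.
have p0 := pi_gt0 R.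
(* By [density_le], [rh / u^5] is at most [1 / (pi (s u^2)^2)] at radius [s], hence at most [K]. Any
   [e] exceeds some value of [u] far out, and the quotient does not increase. *)
pose K := (pi * (q / 4) ^+ 2)^-1.
have ratioK e : 0 < e -> rh e / e ^+ 5 <= K.
  move=> e0; have [s0 s0r1 us0] := potential_small e0.
  pose s := Num.max a s0.
  have as_ : a <= s by rewrite le_max lexx.
  have us : u s < e.
    apply: le_lt_trans us0; apply: potential_nincr; last by rewrite le_max lexx orbT.
    by move: s0r1 r1_gt0; lra.
  have sgt0 := agt0 _ as_; have us0' := au0 _ as_.
  apply: le_trans (rh_div5_nincr us0' (ltW us)) _.
  rewrite /K ler_pdivrMr ?exprn_gt0// mulrC ler_pdivlMr; last first.
    by rewrite mulr_gt0// exprn_gt0// divr_gt0.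
  apply: (@le_trans _ _ (rh (u s) * (pi * (s * u s ^+ 2) ^+ 2))).
    rewrite ler_pM2l ?rh_gt0// ler_pM2l// lerXn2r ?w_ge//.
    - by rewrite nnegrE divr_ge0// ltW.
    - by rewrite nnegrE mulr_ge0 ?sqr_ge0// ltW.
  have -> : rh (u s) * (pi * (s * u s ^+ 2) ^+ 2) = (pi * s ^+ 2 * rh (u s)) * u s ^+ 4.
    by ring.
  by rewrite (exprS _ 4) ler_pM2r ?exprn_gt0// density_le// a1.
(* By monotonicity the supremum [L] is the limit of [rh e / e^5] at 0. *)
pose S := [set rh e / e ^+ 5 | e in [set e | 0 < e]].
have S_ub e : 0 < e -> rh e / e ^+ 5 <= sup S.
  move=> e0; apply: ub_le_sup; last by exists e.
  by exists K => _ [x x0 <-]; exact: ratioK.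
set L := sup S in S_ub.
have L0 : 0 < L.
  apply: lt_le_trans (S_ub 1 ltr01); by rewrite expr1n divr1 rh_gt0.
(* The fraction 2/3 is what [4 P <= e * rh e] requires: [P <= L e^6 / 6] gives
   [4 P <= 2/3 L e^6]. *)
have [e1 e10 Le1] : exists2 e, 0 < e & 2 / 3 * L < rh e / e ^+ 5.
  have [_ [e e0 <-]] := @sup_gt R S (2 / 3 * L) (ex_intro _ _ (ex_intro2 _ _ 1 ltr01 erefl)) ltac:(rewrite -/L; lra).
  by exists e.
have rh_le e : 0 < e -> rh e <= L * e ^+ 5.
  by move=> e0; rewrite -ler_pdivrMr ?exprn_gt0// S_ub.
have rh_ge e : 0 < e -> e <= e1 -> 2 / 3 * L * e ^+ 5 <= rh e.
  move=> e0 ee1; rewrite -ler_pdivlMr ?exprn_gt0//.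
  by apply: le_trans (rh_div5_nincr e0 ee1); exact: ltW.
have P4 e : 0 < e -> e <= e1 -> 4 * P e <= e * rh e.
  move=> e0 ee1; have := P_le_pow6 rh_le e0.
  have := rh_ge _ e0 ee1; rewrite -(ler_pM2l e0).
  have -> : e * (2 / 3 * L * e ^+ 5) = 2 / 3 * (L * e ^+ 6) by ring.
  by lra.
have [s0 s0r1 us0] := potential_small e10.
pose b := Num.max a s0.
have ab : a <= b by rewrite le_max lexx.
have ue1 s : b <= s -> u s <= e1.
  move=> bs; apply: le_trans (ltW us0); apply: potential_nincr.
    by move: s0r1 r1_gt0; lra.
  by apply: le_trans bs; rewrite le_max lexx orbT.
(* [density_le] and [rh >= 2/3 L u^5] bound the square of [w = s u^2]; then [w <= 1 + w^2]. *)
pose W := 1 + (pi * (2 / 3 * L))^-1.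
have W0 : 0 < W by rewrite addr_gt0// invr_gt0 !mulr_gt0// divr_gt0.
have w_le s : b <= s -> s * u s ^+ 2 <= W.
  move=> bs; have as_ := le_trans ab bs.
  have us := au0 _ as_; have sgt0 := agt0 _ as_.
  have : (s * u s ^+ 2) ^+ 2 <= (pi * (2 / 3 * L))^-1.
    rewrite -[leRHS]mul1r ler_pdivlMr; last by rewrite !mulr_gt0// divr_gt0.
    rewrite -(ler_pM2r us) mul1r; apply: le_trans (density_le (a1 _ as_)).
    have -> : (s * u s ^+ 2) ^+ 2 * (pi * (2 / 3 * L)) * u s =
      pi * s ^+ 2 * (2 / 3 * L * u s ^+ 5) by ring.
    by rewrite ler_wpM2l ?rh_ge ?ue1// mulr_ge0 ?sqr_ge0 ?pi_ge0.
  rewrite /W; set w := s * _; have : 0 <= (w - 1) ^+ 2 by exact: sqr_ge0.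
  have : 0 <= w by rewrite mulr_ge0 ?sqr_ge0 ?(ltW sgt0).
  by rewrite sqrrB expr1n mulr1; lra.
have bgt0 : 0 < b by exact: agt0.
(* A lower bound for [z / 2] with [z = 1 / (r u^2)], so the slope grows at least like [h * ln r]. *)
pose h := (2 * W)^-1.
have h0 : 0 < h by rewrite invr_gt0 mulr_gt0.
have wind s : b <= s -> slope b - h * ln b <= slope s - h * ln s.
  move=> bs; apply: (@is_derive_ndecr _ (fun x => slope x - h * ln x)
    (fun x => ((8 * pi * x ^+ 4 * (u x * rh (u x)) + (x * u x) ^+ 2
      - 6 * m x * (x * u x) + 6 * m x ^+ 2) / (x ^+ 4 * u x ^+ 4))
      - (h * x^-1 + ln x * 0)) _ _ bs) => x /andP[bx _]; have ax := le_trans ab bx;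
      have xgt0 := agt0 _ ax; have ux := au0 _ ax.
    apply: is_derive_funB; first exact/is_derive_slope/ar0.
    by apply: is_derive_funM; exact: is_derive1_ln.
  rewrite mulr0 addr0 subr_ge0.
  apply: (@le_trans _ _ ((x * u x) ^+ 2 / 2 / (x ^+ 4 * u x ^+ 4))).
    have -> : (x * u x) ^+ 2 / 2 / (x ^+ 4 * u x ^+ 4) = (2 * (x * u x ^+ 2))^-1 * x^-1.
      by field; rewrite !gt_eqF.
    rewrite ler_pM2r ?invr_gt0// /h lef_pV2 ?posrE ?mulr_gt0 ?exprn_gt0//.
    by rewrite ler_pM2l// w_le.
  rewrite ler_pM2r; last by rewrite invr_gt0 mulr_gt0// exprn_gt0.
  (* With [y = x u] and [z = m], positivity of the Pohozaev function and [4 P <= u * rh u] bound the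
     density term below by [4 z y - 4 z^2]. The numerator is then at least [y^2 - 2 z y + 2 z^2 =
     y^2 / 2 + (y - 2 z)^2 / 2]. *)
  have Q1 : 0 <= pohozaev x by apply: le_trans (qQ _ ax); exact: ltW.
  have Q2 : 0 <= 8 * x * pohozaev x by rewrite mulr_ge0// mulr_ge0// ltW.
  have Q3 : 8 * x * pohozaev x =
      8 * pi * x ^+ 4 * (4 * P (u x)) - 4 * (m x * (x * u x) - m x ^+ 2).
    by rewrite /pohozaev; field; rewrite gt_eqF.
  have Q4 : 8 * pi * x ^+ 4 * (4 * P (u x)) <= 8 * pi * x ^+ 4 * (u x * rh (u x)).
    rewrite ler_wpM2l ?P4 ?ue1//.
    by rewrite !mulr_ge0 ?pi_ge0 ?exprn_ge0 ?(ltW xgt0).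
  rewrite Q3 in Q2.
  have : 0 <= (x * u x - 2 * m x) ^+ 2 by exact: sqr_ge0.
  move: Q2 Q4; set A := 8 * pi * x ^+ 4 * _; set B := 8 * pi * x ^+ 4 * _.
  set y := x * u x; set z := m x.
  have -> : (y - 2 * z) ^+ 2 = y ^+ 2 - 4 * (z * y) + 4 * z ^+ 2 by ring.
  have -> : 6 * z * y = 6 * (z * y) by ring.
  by lra.
have k_le s : b <= s -> `|slope s| <= (q / 4)^-1.
  move=> bs; have as_ := le_trans ab bs.
  apply: le_trans (slope_bound (a1' _ as_)) _.
  have q40 : 0 < q / 4 by rewrite divr_gt0.
  have wge := w_ge _ as_.
  by rewrite lef_pV2 ?posrE// (lt_le_trans q40).
(* Over a factor [expR N] in radius the slope gains more than the distance [2 * (q / 4)^-1] that its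
   bound permits. *)
pose N := (2 * (q / 4)^-1 + 1) / h.
have N0 : 0 <= N by rewrite divr_ge0 ?(ltW h0)// addr_ge0// mulr_ge0// invr_ge0 divr_ge0// ltW.
have bN : b <= b * expR N.
  by rewrite ler_peMr ?(ltW bgt0)// -expR0 ler_expR.
have := wind _ bN; rewrite lnM ?posrE ?expR_gt0// expRK mulrDr.
have -> : h * N = 2 * (q / 4)^-1 + 1 by rewrite /N; field; rewrite !gt_eqF.
have := k_le _ (lexx b); have := k_le _ bN.
by rewrite !ler_norml => /andP[? ?] /andP[? ?]; lra.
Qed.

End PositiveMass.
End Star.
End GlobalSolutions.

(** * Continuation across a finite radius *)

Section FiniteRadius.
Local Open Scope classical_set_scope.
Local Open Scope ring_scope.
Variable R : realType.
Implicit Types (a b c d e r s x y z : R) (f g : R -> R).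

Lemma ndecr_left_limit f a b M : a < b ->
  (forall x y, a < x -> x <= y -> y < b -> f x <= f y) ->
  (forall x, a < x < b -> f x <= M) -> exists l : R, f x @[x --> b^'-] --> l.
Proof.
move=> ab fnd fM; apply/cvg_ex; apply: nondecreasing_at_left_is_cvgr.
- near=> c => x y; rewrite !in_itv/= => /andP[cx xb] /andP[cy yb] xy.
  apply: fnd => //; apply: le_lt_trans cx.
  by near: c; exact: nbhs_left_ge.
- near=> c; exists M => _ [x /= + <-]; rewrite in_itv/= => /andP[cx xb].
  apply: fM; rewrite xb andbT; apply: le_lt_trans cx.
  by near: c; exact: nbhs_left_ge.
Unshelve. all: by end_near. Qed.

Lemma glue_continuous f g c l : f x @[x --> c^'-] --> l ->
  {for c, continuous g} -> g c = l ->
  {for c, continuous (fun x => if x < c then f x else g x)}.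
Proof.
move=> fl gc gl; apply/left_right_continuousP; rewrite ltxx gl; split.
- apply: cvg_trans fl; apply: near_eq_cvg; near=> x.
  by rewrite ifT//; near: x; exact: nbhs_left_lt.
- rewrite -gl; apply: (@cvg_trans _ (g @ c^'+)).
    apply: near_eq_cvg; near=> x; rewrite ifF//; apply/negbTE.
    by rewrite -leNgt ltW//; near: x; exact: nbhs_right_gt.
  exact: cvg_at_right_filter.
Unshelve. all: by end_near. Qed.

(** * Local solutions of the structure equations and their gluing *)

Variables (rh drh : R -> R).
Hypothesis rh_gt0 : forall e, 0 < e -> 0 < rh e.
Hypothesis rhD : forall e, 0 < e -> is_derive e 1 rh (drh e).
Hypothesis drh_ge0 : forall e, 0 < e -> 0 <= drh e.
Hypothesis drh_le : forall e, 0 < e -> e * drh e <= 5 * rh e.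

Lemma rh_clamp_continuous c d : 0 < c -> c <= d ->
  continuous (fun x => rh (clamp c d x)).
Proof.
move=> c0 cd x; apply: (@continuous_comp _ _ _ (clamp c d)).
  exact: clamp_continuous.
have /andP[cx _] := clamp_itv x cd.
by apply: is_derive_continuous; apply: rhD; exact: lt_le_trans cx.
Qed.

(** On [[c, d]] the bound [n <= 5] gives [drh z <= 5 rh z / z <= 5 rh d / c]. *)
Lemma rh_clamp_lipschitz c d x y : 0 < c -> c <= d ->
  `|rh (clamp c d x) - rh (clamp c d y)| <= 5 * rh d / c * `|x - y|.
Proof.
move=> c0 cd.
have d0 : 0 < d by exact: lt_le_trans cd.
apply: (@le_trans _ _ (5 * rh d / c * `|clamp c d x - clamp c d y|)); last first.
  rewrite ler_wpM2l ?clamp_lip//.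
  by rewrite divr_ge0 ?(ltW c0)// mulr_ge0// ltW// rh_gt0.
have := clamp_itv x cd; have := clamp_itv y cd.
move: (clamp c d x) (clamp c d y) => {x y} x y.
wlog : x y / x < y.
  move=> H yi xi; have [xy|yx|->] := ltgtP x y; first exact: H.
    by rewrite distrC (distrC x); exact: H.
  by rewrite !subrr !normr0 mulr0.
move=> xy /andP[cy yd] /andP[cx xd].
have [|z /andP[xz zy] E] := @mean_value _ rh drh _ _ xy.
  by move=> w /andP[xw _]; apply: rhD; lra.
have z0 : 0 < z by lra.
rewrite distrC E distrC normrM (ger0_norm (drh_ge0 z0)) ler_wpM2r//.
rewrite ler_pdivlMr//; apply: (@le_trans _ _ (z * drh z)).
  by rewrite mulrC ler_wpM2r ?drh_ge0//; lra.
apply: le_trans (drh_le z0) _; rewrite ler_pM2l//.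
by apply: (rh_ndecr rhD drh_ge0) => //; lra.
Qed.

(** Truncating both the radius and the enthalpy makes the right-hand sides globally Lipschitz. The
    truncations have no effect near [r], where the enthalpy stays strictly between [c] and [d]. *)
Lemma star_local_existence r m1 u1 : 0 < r -> 0 < u1 ->
  exists e (m u : R -> R), [/\ 0 < e, m r = m1, u r = u1 &
    forall x, r - e < x < r + e -> [/\ 0 < u x,
      is_derive x 1 m (4 * pi * x ^+ 2 * rh (u x)) &
      is_derive x 1 u (- m x / x ^+ 2)]].
Proof.
move=> r0 u10.
have p0 := pi_gt0 R.
pose c := u1 / 2; pose d := 2 * u1.
have c0 : 0 < c by rewrite divr_gt0.
have cd : c <= d by rewrite /c /d; lra.
have d0 := lt_le_trans c0 cd.
pose L := 5 * rh d / c.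
have L0 : 0 < L by rewrite divr_gt0// mulr_gt0// rh_gt0.
(* The sum of the Lipschitz constants of the two right-hand sides for radii in [[r / 2, 2 * r]];
   [e <= 1 / (4 K)] makes the interval of length [2 e] short enough. *)
pose K := 4 * pi * (2 * r) ^+ 2 * L + (r / 2) ^- 2.
have K1 : 0 <= 4 * pi * (2 * r) ^+ 2 * L.
  by rewrite mulr_ge0 ?(ltW L0)// !(sqr_ge0, pi_ge0, mulr_ge0).
have K2 : 0 < (r / 2) ^- 2 by rewrite invr_gt0 exprn_gt0// divr_gt0.
have K0 : 0 < K by rewrite ltr_wpDl.
pose e := Num.min (r / 2) (4 * K)^-1.
have e0 : 0 < e by rewrite lt_min divr_gt0// invr_gt0 mulr_gt0.
have er : e <= r / 2 by rewrite ge_min lexx.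
have eK : e <= (4 * K)^-1 by rewrite ge_min lexx orbT.
pose cl := clamp (r - e) (r + e).
have cl_bd x : r / 2 <= cl x <= 2 * r.
  have /(clamp_itv x)/andP[] : r - e <= r + e by lra.
  by rewrite -/cl => *; apply/andP; split; move: r0; lra.
have clc : continuous cl by exact: clamp_continuous.
pose f x y := 4 * pi * cl x ^+ 2 * rh (clamp c d y).
pose g x y := - y / cl x ^+ 2.
have cl2c : continuous (fun x => cl x ^+ 2).
  by move=> x; apply: (@continuous_comp _ _ _ cl (fun y : R => y ^+ 2)); [exact: clc|exact: exprn_continuous].
(* Here [u] is the mass and [v] the enthalpy. *)
have [||||||u [v [uc vc ur vr uvD]]] := @ode_local_existence R f g (r - e) (r + e) r m1 u1 K.
- by apply/andP; split; lra.
- move=> u uc x; apply: (@continuousM _ _ (fun x => 4 * pi * cl x ^+ 2)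
    (fun x => rh (clamp c d (u x)))).
    by apply: (@continuousM _ _ (cst (4 * pi)) (fun x => cl x ^+ 2));
      [exact: cst_continuous|exact: cl2c].
  by apply: (@continuous_comp _ _ _ u (fun y => rh (clamp c d y)));
    [exact: uc|exact: rh_clamp_continuous].
- move=> u uc x; apply: (@continuousM _ _ (fun x => - u x) (fun x => (cl x ^+ 2)^-1)).
    by apply: continuousN; exact: uc.
  apply: continuousV; last exact: cl2c.
  rewrite expf_neq0// gt_eqF//; have /andP[clx _] := cl_bd x.
  by move: r0 clx; lra.
- move=> x y z; rewrite /f -mulrBr normrM.
  have /andP[clx1 clx2] := cl_bd x.
  have cl0 : 0 <= cl x by move: r0 clx1; lra.
  apply: (@le_trans _ _ (4 * pi * (2 * r) ^+ 2 * (L * `|y - z|))).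
    apply: ler_pM => //; last exact: rh_clamp_lipschitz.
    rewrite ger0_norm; last by rewrite !(sqr_ge0, pi_ge0, mulr_ge0).
    by rewrite ler_wpM2l ?lerXn2r ?nnegrE ?mulr_ge0 ?(ltW r0) ?pi_ge0.
  rewrite mulrA ler_wpM2r// /K lerDl; exact: ltW.
- move=> x y z; rewrite /g -mulrBl normrM opprK addrC distrC mulrC.
  have /andP[clx1 _] := cl_bd x.
  have r20 : 0 < r / 2 by rewrite divr_gt0.
  have cl0 : 0 < cl x by exact: lt_le_trans clx1.
  apply: ler_pM => //.
  rewrite gtr0_norm ?invr_gt0 ?exprn_gt0// (@le_trans _ _ ((r / 2) ^- 2))//.
    by rewrite lef_pV2 ?posrE ?exprn_gt0// lerXn2r// nnegrE ltW.
  by rewrite /K lerDr.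
- have -> : K * (r + e - (r - e)) = 2 * K * e by ring.
  apply: (@le_trans _ _ (2 * K * (4 * K)^-1)).
    by rewrite ler_wpM2l// mulr_ge0// ltW.
  by rewrite le_eqVlt; apply/orP; left; apply/eqP; field; rewrite gt_eqF.
have u1cd : v r \in `]c, d[ by rewrite vr in_itv/= /c /d; apply/andP; split; lra.
have [/= e1 e10 ve1] : \forall x \near r, v x \in `]c, d[.
  exact: (vc r _ (near_in_itvoo u1cd)).
exists (Num.min e e1), u, v; split => //; first by rewrite lt_min e0.
move=> x /andP[xl xr].
have me : Num.min e e1 <= e by rewrite ge_min lexx.
have me1 : Num.min e e1 <= e1 by rewrite ge_min lexx orbT.
have xe : r - e < x < r + e by apply/andP; split; lra.
have : v x \in `]c, d[.
  by apply: ve1; rewrite /= ltr_norml; apply/andP; split; lra.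
rewrite in_itv/= => /andP[cv vd].
have [duu dvv] := uvD _ xe.
have clx : cl x = x by apply: clamp_id; case/andP: xe => *; rewrite !ltW.
split; first exact: lt_trans cv.
  by move: duu; rewrite /f clx clamp_id// !ltW.
by move: dvv; rewrite /g clx.
Qed.

Definition star_on (r0 R0 : R) (m u : R -> R) := forall r, r0 < r < R0 -> [/\ 0 < u r,
  is_derive r 1 m (4 * pi * r ^+ 2 * rh (u r)) &
  is_derive r 1 u (- m r / r ^+ 2)].

(** A local solution with the limits as data at [R0] is glued on. The glued functions are continuous
    at [R0], so [is_derive_lim] gives the equations there. *)
Lemma star_extension r0 R0 (m u : R -> R) (m1 u1 : R) : 0 <= r0 -> r0 < R0 -> star_on r0 R0 m u ->
  m x @[x --> R0^'-] --> m1 -> u x @[x --> R0^'-] --> u1 -> 0 < u1 ->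
  exists R1 (m' u' : R -> R), [/\ R0 < R1, star_on r0 R1 m' u' &
    forall r, r < R0 -> m' r = m r /\ u' r = u r].
Proof.
move=> r00 r0R0 st mm1 uu1 u10.
have R0_gt0 : 0 < R0 by exact: le_lt_trans r0R0.
have [e [M [U [e0 MR UR MUD]]]] := star_local_existence m1 R0_gt0 u10.
pose m' x := if x < R0 then m x else M x.
pose u' x := if x < R0 then u x else U x.
have [UR0 MD UD] : [/\ 0 < U R0, is_derive R0 1 M (4 * pi * R0 ^+ 2 * rh (U R0))
    & is_derive R0 1 U (- M R0 / R0 ^+ 2)].
  by apply: MUD; apply/andP; split; lra.
have m'c : {for R0, continuous m'}.
  by apply: (glue_continuous mm1 _ MR); exact: is_derive_continuous MD.
have u'c : {for R0, continuous u'}.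
  by apply: (glue_continuous uu1 _ UR); exact: is_derive_continuous UD.
have off x : r0 < x < R0 + e -> x != R0 -> [/\ 0 < u' x,
    is_derive x 1 m' (4 * pi * x ^+ 2 * rh (u' x)) &
    is_derive x 1 u' (- m' x / x ^+ 2)].
  move=> /andP[rx xR]; rewrite neq_lt => /orP[xR0|Rx].
    have [ux mx vx] := st x (introT andP (conj rx xR0)).
    rewrite /u' /m' !xR0; split => //.
    - apply: is_derive_near mx; near=> y; rewrite ifT//.
      by near: y; exact: lt_nbhsl.
    - apply: is_derive_near vx; near=> y; rewrite ifT//.
      by near: y; exact: lt_nbhsl.
  have xi : R0 - e < x < R0 + e by apply/andP; split; lra.
  have [ux mx vx] := MUD x xi.
  have xF : (x < R0) = false by rewrite ltNge (ltW Rx).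
  rewrite /u' /m' !xF; split => //.
  - apply: is_derive_near mx; near=> y; rewrite ifF//.
    by apply/negbTE; rewrite -leNgt ltW//; near: y; exact: lt_nbhsr.
  - apply: is_derive_near vx; near=> y; rewrite ifF//.
    by apply/negbTE; rewrite -leNgt ltW//; near: y; exact: lt_nbhsr.
have near_off : \forall y \near R0, y != R0 -> r0 < y < R0 + e.
  have Rin : R0 \in `]r0, (R0 + e)[ by rewrite in_itv/= r0R0 ltrDl.
  near=> y; move=> _; have : y \in `]r0, (R0 + e)[ by near: y; exact: near_in_itvoo.
  by rewrite in_itv.
have u'R : u' R0 = u1 by rewrite /u' ltxx.
have sqc : {for R0, continuous (fun x => x ^+ 2)} by exact: exprn_continuous.
exists (R0 + e), m', u'; split; first by rewrite ltrDl.
  move=> x xi; have [->{x xi}|] := eqVneq x R0; last exact: off.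
  split; first by rewrite u'R.
  - apply: (@is_derive_lim _ m' (fun x => 4 * pi * x ^+ 2 * rh (u' x))) => //.
      apply: (@continuousM _ _ (fun x => 4 * pi * x ^+ 2) (rh \o u')).
        by apply: (@continuousM _ _ (cst (4 * pi)) (fun x => x ^+ 2)) => //; exact: cst_continuous.
      apply: continuous_comp => //.
      by apply: is_derive_continuous; apply: rhD; rewrite u'R.
    near=> y; move=> yR.
    have yi : r0 < y < R0 + e by move: yR; near: y.
    by have [] := off y yi yR.
  - apply: (@is_derive_lim _ u' (fun x => - m' x / x ^+ 2)) => //.
      apply: (@continuousM _ _ (fun x => - m' x) (fun x => (x ^+ 2)^-1)).
        exact: continuousN.
      by apply: continuousV => //; rewrite expf_neq0// gt_eqF.
    near=> y; move=> yR.
    have yi : r0 < y < R0 + e by move: yR; near: y.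
    by have [] := off y yi yR.
by move=> r rR; rewrite /m' /u' rR.
Unshelve. all: by end_near. Qed.

(** Both limits come from monotonicity: [m] is nondecreasing, and so is [A * x - u x] for a suitable
    [A]. The latter bounds [u], hence the density, hence [m]. *)
Lemma star_left_limits r0 R0 (m u : R -> R) : 0 <= r0 -> r0 < R0 -> star_on r0 R0 m u ->
  exists m1 u1 : R, [/\ m x @[x --> R0^'-] --> m1, u x @[x --> R0^'-] --> u1 & 0 <= u1].
Proof.
move=> r00 r0R0 st.
pose a := (r0 + R0) / 2.
have r0a : r0 < a by rewrite /a; lra.
have aR0 : a < R0 by rewrite /a; lra.
have a0 : 0 < a by exact: le_lt_trans r0a.
have R00 : 0 < R0 by exact: lt_trans aR0.
have mnd x y : a <= x -> x <= y -> y < R0 -> m x <= m y.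
  move=> ax xy yR; apply: (@is_derive_ndecr _ m _ _ _ xy) => z /andP[xz zy];
    have [uz mz _] := st z ltac:(apply/andP; split; lra); first exact: mz.
  by rewrite !(sqr_ge0, pi_ge0, mulr_ge0)// ltW// rh_gt0.
(* Since [m >= m a] beyond [a], this bounds [u' = - m / x^2] from above. *)
pose A := `|m a| / a ^+ 2.
have A0 : 0 <= A by rewrite divr_ge0 ?sqr_ge0.
have und x y : a <= x -> x <= y -> y < R0 -> A * x - u x <= A * y - u y.
  move=> ax xy yR; apply: (@is_derive_ndecr _ (fun x => A * x - u x)
    (fun x => A * 1 + x * 0 - (- m x / x ^+ 2)) _ _ xy) => z /andP[xz zy];
    have [uz mz vz] := st z ltac:(apply/andP; split; lra).
    by apply: is_derive_funB.
  have az : a <= z by lra.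
  rewrite mulr1 mulr0 addr0 mulNr opprK.
  have : - `|m a| <= m z.
    by apply: le_trans (mnd a z (lexx a) az _); [rewrite lerNl -normrN ler_norm|lra].
  have z2 : 0 < (z ^+ 2)^-1 by rewrite invr_gt0 exprn_gt0//; lra.
  rewrite -(ler_pM2r z2) mulNr.
  suff : `|m a| / z ^+ 2 <= A by lra.
  rewrite ler_wpM2l// lef_pV2 ?posrE ?exprn_gt0//; last by lra.
  by rewrite lerXn2r// nnegrE; lra.
pose U := u a + A * (R0 - a).
have uU x : a <= x -> x < R0 -> u x <= U.
  move=> ax xR; have := und a x (lexx a) ax xR.
  have : A * x <= A * R0 by rewrite ler_wpM2l// ltW.
  by rewrite /U mulrBr; lra.
have [m1 mm1] : exists m1 : R, m x @[x --> R0^'-] --> m1.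
  pose B := 4 * pi * R0 ^+ 2 * rh U.
  apply: (@ndecr_left_limit _ a R0 (m a + B * (R0 - a)) aR0).
    by move=> x y ax; apply: mnd; exact: ltW.
  move=> x /andP[/ltW ax xR].
  have [ua _ _] := st a ltac:(apply/andP; split; lra).
  have U0 : 0 < U.
    by rewrite ltr_pwDl// mulr_ge0// subr_ge0 ltW.
  have B0 : 0 <= B by rewrite !(sqr_ge0, pi_ge0, mulr_ge0)// ltW// rh_gt0.
  suff : B * a - m a <= B * x - m x.
    have : B * x <= B * R0 by rewrite ler_wpM2l// ltW.
    by rewrite mulrBr; lra.
  apply: (@is_derive_ndecr _ (fun x => B * x - m x)
    (fun x => B * 1 + x * 0 - 4 * pi * x ^+ 2 * rh (u x)) _ _ ax) => z /andP[az zx];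
    have [uz mz vz] := st z ltac:(apply/andP; split; lra).
    by apply: is_derive_funB.
  rewrite mulr1 mulr0 addr0 subr_ge0 /B ler_pM//.
  - by rewrite !(sqr_ge0, pi_ge0, mulr_ge0).
  - by rewrite ltW// rh_gt0.
  - rewrite ler_wpM2l ?mulr_ge0 ?pi_ge0// lerXn2r ?nnegrE//; lra.
  - apply: (rh_ndecr rhD drh_ge0) => //; apply: uU => //; lra.
have [l hl] : exists l : R, (A * x - u x) @[x --> R0^'-] --> l.
  apply: (@ndecr_left_limit _ a R0 (A * R0) aR0).
    by move=> x y ax; apply: und; exact: ltW.
  move=> x /andP[ax xR]; have [ux _ _] := st x ltac:(apply/andP; split; lra).
  have : A * x <= A * R0 by rewrite ler_wpM2l// ltW.
  by lra.
have Ax : (A * x) @[x --> R0^'-] --> A * R0.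
  by apply: cvg_at_left_filter; apply: cvgMr; exact: cvg_id.
have uu1 : u x @[x --> R0^'-] --> A * R0 - l.
  have -> : u = fun x => A * x - (A * x - u x) by apply/funext => x; ring.
  exact: cvgB Ax hl.
exists m1, (A * R0 - l); split => //.
apply: (cvgr_to_ge uu1); near=> x.
have [] // := st x _ => [|/ltW//].
apply/andP; split; near: x; [exact: nbhs_left_gt|exact: nbhs_left_lt].
Unshelve. all: by end_near. Qed.

End FiniteRadius.

(** Of the three terms, the square is nonnegative and the pressure term positive. The remaining one
    is positive for negative mass and tends to 0 at a regular center. *)
Lemma pohozaev_ge (R : realType) (P m u : R -> R) (r : R) : 0 < r -> 0 < P (u r) ->
  - (m r * u r) / 2 < pohozaev P m u r.
Proof.
move=> r0 P0; rewrite /pohozaev.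
have : 0 <= m r ^+ 2 / (2 * r) by rewrite divr_ge0 ?sqr_ge0// mulr_ge0// ltW.
have : 0 < 4 * pi * r ^+ 3 * P (u r) by rewrite !mulr_gt0 ?pi_gt0 ?exprn_gt0.
by lra.
Qed.

(** * The finite and infinite alternatives for the radius, and the two kinds of center *)

Unset Implicit Arguments. Set Strict Implicit. Set Printing Implicit Defensive.

Theorem theorem3 (R : realType) (rho Pe : R -> R) :
  barotropic_eos rho Pe ->
  asymptotically_polytropic rho Pe ->
  (forall e : R, 0 < e -> n_index rho Pe e <= 5) ->
  (exists d : R, 0 < d /\ forall e : R, 0 < e < d -> n_index rho Pe e < 5) ->
  forall (r0 : R) (Rad : \bar R) (m p : R -> R),
    maximal_fluid_solution rho r0 Rad m p ->
    regular_center r0 m p \/ negative_mass_center r0 m p ->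
    finite_radius_mass Rad m p.
Proof.
move=> eos [smooth [B nB] _] n5 [d [d0 nd]] r0 Rad m p [[r00 r0R sol] maxl] center.
pose rh := rho_eta rho Pe; pose drh : R -> R := derive1 rh.
have [rho0 _ PeK _] := eos.
have rhoD (e : R) : 0 < e -> derivable (rho_eta rho Pe) e 1 by move=> /smooth[].
have rh_gt0 (e : R) : 0 < e -> 0 < rh e by move=> e0; exact/rho0/(Pe_gt0 eos).
have rhD (e : R) : 0 < e -> is_derive e 1 rh (drh e).
  by move=> e0; rewrite /drh derive1E; apply: derivableP; exact: rhoD.
have nE (e : R) : 0 < e -> n_index rho Pe e * rh e = e * drh e.
  by move=> e0; rewrite /n_index -/rh -/(drh e); field; rewrite gt_eqF ?rh_gt0.
have drh_ge0 (e : R) : 0 < e -> 0 <= drh e.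
  move=> e0; have /andP[n0 _] := nB _ e0.
  by rewrite -(pmulr_rge0 _ e0) -nE// mulr_ge0// ltW// rh_gt0.
have drh_le (e : R) : 0 < e -> e * drh e <= 5 * rh e.
  by move=> e0; rewrite -nE// ler_pM2r ?rh_gt0// n5.
have drh_lt : exists2 d : R, 0 < d & forall e : R, 0 < e < d -> e * drh e < 5 * rh e.
  exists d => // e ed; have /andP[e0 _] := ed.
  by rewrite -nE// ltr_pM2r ?rh_gt0// nd.
have Peg := Pe_gt0 eos; have PeD := is_derive_Pe eos rhoD.
pose u r := eta_of rho (p r).
have u_gt0 (r : R) : 0 < p r -> 0 < u r by move=> pr; exact: (eta_of_gt0 eos).
have star (r : R) : r0 < r -> (r%:E < Rad)%E -> [/\ 0 < u r,
    is_derive r 1 m (4 * pi * r ^+ 2 * rh (u r)) &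
    is_derive r 1 u (- m r / r ^+ 2)].
  move=> rr rR; have [pr mr dpr] := sol r rr rR.
  split; first exact: u_gt0.
    by rewrite /rh (rho_eta_eta_of eos).
  have -> : - m r / r ^+ 2 = (rho (p r))^-1 * (- (m r * rho (p r)) / r ^+ 2).
    field; rewrite !gt_eqF ?rho0//; exact: le_lt_trans rr.
  by apply: is_derive1_comp; exact: (is_derive_eta_of eos rhoD).
case: Rad r0R sol maxl star => [R0||//] r0R sol maxl star.
- rewrite lte_fin in r0R.
  have st : star_on rh r0 R0 m u by move=> r /andP[rr rR]; apply: star.
  have [m1 [u1 [mm1 uu1 u1_ge0]]] := star_left_limits rh_gt0 rhD drh_ge0 r00 r0R st.
  exists R0; split => //; split; last by exists m1.
  (* With a positive limit the extension, turned back into a pressure by [Pe], would contradict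
     maximality. *)
  have u10 : u1 = 0.
    apply/eqP; rewrite eq_le u1_ge0 andbT leNgt; apply/negP => u1_gt0.
    have [R1 [m' [u' [R01 st' agree]]]] :=
      star_extension rh_gt0 rhD drh_ge0 drh_le r00 r0R st mm1 uu1 u1_gt0.
    have := maxl R1%:E m' (Pe \o u'); rewrite lee_fin leNgt R01 /= => absurd.
    suff : false by []; apply: absurd; last first.
      move=> r rr; rewrite lte_fin => rR; have [-> ->] := agree r rR.
      split => //; apply: PeK; have [pr _ _] := sol r rr rR; exact: ltW.
    split => //; first by rewrite lte_fin (lt_trans r0R).
    move=> r rr; rewrite lte_fin => rR.
    have [ur mr dur] := st' r (introT andP (conj rr rR)).
    split => //=; first exact: Peg.
    rewrite -[rho (Pe (u' r))]/(rh (u' r)).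
    have -> : - (m' r * rh (u' r)) / r ^+ 2 = rh (u' r) * (- m' r / r ^+ 2) by ring.
    by apply: is_derive1_comp; exact: PeD.
  apply/cvgrPdist_lt => e e0.
  have he0 := eta_of_gt0 eos e0.
  move/cvgrPdist_lt : uu1 => /(_ _ he0); rewrite u10 => ue.
  near=> r; rewrite sub0r normrN.
  have [pr _ _] : [/\ 0 < p r, True & True].
    have rr : r0 < r by near: r; exact: nbhs_left_gt.
    have rR : r < R0 by near: r; exact: nbhs_left_lt.
    by have [? _ _] := sol r rr rR.
  rewrite gtr0_norm// ltNge; apply/negP => ep.
  have : `|0 - u r| < eta_of rho e by near: r.
  rewrite sub0r normrN gtr0_norm ?u_gt0// ltNge => /negP; apply.
  move: ep; rewrite le_eqVlt => /predU1P[->//|ep].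
  by apply: ltW; apply: (eta_of_lt eos) => //; exact: ltW.
(* The radius is now infinite: the Pohozaev function is nowhere positive, and each center
   contradicts this. *)
exfalso.
have sp (r : R) : r0 < r -> 0 < p r by move=> rr; have [] := sol r rr (ltry _).
have su (r : R) : r0 < r -> 0 < u r by move=> rr; exact/u_gt0/sp.
have sm (r : R) : r0 < r -> is_derive r 1 m (4 * pi * r ^+ 2 * rh (u r)).
  by move=> rr; have [] := star r rr (ltry _).
have sd (r : R) : r0 < r -> is_derive r 1 u (- m r / r ^+ 2).
  by move=> rr; have [] := star r rr (ltry _).
have Psm := Pe_small eos.
have [r1 r01 m1] := mass_eventually_gt0 rh_gt0 rhD drh_ge0 r00 su sm sd.
have Q_le0 (r : R) : r0 < r -> pohozaev Pe m u r <= 0.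
  exact: (global_pohozaev_le0 rh_gt0 rhD drh_ge0 drh_le drh_lt Peg PeD Psm
    r00 su sm sd r01 m1).
have Q_ge (r : R) : r0 < r -> - (m r * u r) / 2 < pohozaev Pe m u r.
  by move=> rr; apply: pohozaev_ge; [exact: le_lt_trans rr|exact/Peg/su].
case: center => [[r0E [m0 [pc [pc0 ppc]]]]|[M [M0 [mM _]]]].
(* The function increases strictly from a lower limit at least 0 at the center, so it would be
   positive at 1. *)
- have r0h : r0 < 2^-1 by rewrite r0E invr_gt0.
  have : pohozaev Pe m u 2^-1 < pohozaev Pe m u 1.
    apply: (pohozaev_incr rh_gt0 rhD drh_ge0 drh_le drh_lt Peg PeD r00 su sm sd) => //.
    by rewrite invf_lt1// ltr1n.
  have := Q_le0 1; rewrite r0E => /(_ ltr01).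
  suff : 0 <= pohozaev Pe m u 2^-1 by lra.
  apply/ler_addgt0Pl => e e0.
  (* Near the center [p < pc + 1], so [u < b]; with [|m s| < e / b] the product [m u] is at most
     [e]. *)
  pose b := eta_of rho (pc + 1).
  have b0 : 0 < b by apply: (eta_of_gt0 eos); lra.
  have eb : 0 < e / b by rewrite divr_gt0.
  move/cvgrPdist_lt : m0 => /(_ _ eb) m0.
  move/cvgrPdist_lt : ppc => /(_ _ ltr01) ppc.
  near ((0 : R)^'+)%classic => s.
  have s0 : 0 < s by near: s; exact: nbhs_right_gt.
  have sh : s < 2^-1 by near: s; apply: nbhs_right_lt; rewrite invr_gt0.
  have r0s : r0 < s by rewrite r0E.
  have ms : `|m s| < e / b by rewrite -normrN -sub0r; near: s.
  have ps : `|pc - p s| < 1 by near: s.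
  have usb : u s < b.
    apply: (eta_of_lt eos); first exact/ltW/sp.
    by move: ps; rewrite ltr_norml => /andP[]; lra.
  have := pohozaev_incr rh_gt0 rhD drh_ge0 drh_le drh_lt Peg PeD r00 su sm sd r0s sh.
  have := Q_ge _ r0s.
  have : m s * u s <= e.
    apply: le_trans (ler_norm _) _; rewrite normrM (gtr0_norm (su _ r0s)).
    have -> : e = e / b * b by field; rewrite gt_eqF.
    by apply: ler_pM; [exact: normr_ge0|exact/ltW/su|exact: ltW|exact: ltW].
  by lra.
(* Close to [r0] the mass is still negative, so [- m u / 2] alone is positive. *)
have M0' : 0 < - M by rewrite oppr_gt0.
move/cvgrPdist_lt : mM => /(_ _ M0') mM.
near (r0^'+)%classic => s.
have r0s : r0 < s by near: s; exact: nbhs_right_gt.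
have : `|M - m s| < - M by near: s.
rewrite ltr_norml => /andP[Ms _].
have ms : m s < 0 by lra.
have := Q_ge _ r0s; have := Q_le0 _ r0s.
by have := su _ r0s; nra.
Unshelve. all: by end_near. Qed.
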